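(* Let $a,b,c,d,e\in\mathbb{R}$ with $b\neq 0$, let $\mu\geq -1/2$, and let $f,g\in L^2_\mu(\mathbb{R})$. Then $$\int_{\mathbb{R}}f(v)\,\overline{g(v)}\,|v|^{2\mu+1}\,dv=\int_{\mathbb{R}}\mathcal{D}^{a,b,c}_{d,e,\mu}[f](w)\,\overline{\mathcal{D}^{a,b,c}_{d,e,\mu}[g](w)}\,|w|^{2\mu+1}\,dw.$$
   Context: For $\mu\ge -1/2$ and $1\le p<\infty$, $L^p_\mu(\mathbb{R})$ is the space of measurable $f:\mathbb{R}\to\mathbb{C}$ with $\|f\|_{\mu,p}=\left(\int_{\mathbb{R}}|f(v)|^p|v|^{2\mu+1}dv\right)^{1/p}<\infty$. Put $c_\mu=\frac{1}{2^{\mu+1}\Gamma(\mu+1)}$. The normalized spherical Bessel function is $j_\mu(z)=\Gamma(\mu+1)\sum_{n=0}^{\infty}\frac{(-1)^n (z/2)^{2n}}{n!\,\Gamma(n+\mu+1)}$, and the Dunkl kernel is $E_\mu(iw,v)=j_\mu(wv)+\frac{iwv}{2(\mu+1)}\,j_{\mu+1}(wv)$ for $w,v\in\mathbb{R}$. For real $a,b,c,d,e$ with $b\neq0$, the quadratic-phase Dunkl kernel is $\Psi^{a,b,c}_{d,e,\mu}(w,v)=e^{-i(av^2+cw^2+dv+ew)}E_\mu(-iw/b,v)$, and the quadratic-phase Dunkl transform of $f\in L^1_\mu(\mathbb{R})$ is $\mathcal{D}^{a,b,c}_{d,e,\mu}[f](w)=\frac{c_\mu}{(ib)^{\mu+1}}\int_{\mathbb{R}}\Psi^{a,b,c}_{d,e,\mu}(w,v)f(v)|v|^{2\mu+1}dv$.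 Complex powers are taken with the principal branch. On $L^2_\mu(\mathbb{R})$, $\mathcal{D}^{a,b,c}_{d,e,\mu}$ denotes the unique continuous linear operator $L^2_\mu(\mathbb{R})\to L^2_\mu(\mathbb{R})$ that agrees with the integral formula on the Schwartz space $\mathcal{S}(\mathbb{R})$. *)

(* Defs.v *)
From mathcomp Require Import all_boot all_order all_algebra.
From mathcomp Require Import complex.
From mathcomp Require Import all_classical all_reals all_analysis.
Set Implicit Arguments.
Unset Strict Implicit.
Unset Printing Implicit Defensive.
Import Order.TTheory GRing.Theory Num.Theory.
Import numFieldNormedType.Exports.
Local Open Scope classical_set_scope.
Local Open Scope ring_scope.
Local Open Scope complex_scope.

Section QuadraticPhaseDunkl.
Context {R : realType}.
Implicit Types (a b c d e mu s v w x : R) (z : R[i]) (f g : R -> R[i]).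

Local Notation leb := (@lebesgue_measure R).

Definition Gamma x : R :=
  \int[leb]_(t in `]0, +oo[) (t `^ (x - 1) * expR (- t)).

Definition expi x : R[i] := cos x +i* sin x.

(* Principal argument, with values in ]-pi, pi] for z != 0. *)
Definition Arg z : R :=
  let t := acos (complex.Re z / complex.Re `|z|) in
  if 0 <= complex.Im z then t else - t.

(* Principal branch of z ^ s, for z != 0. *)
Definition cpow z s : R[i] := (complex.Re `|z| `^ s)%:C * expi (s * Arg z).

Definition cintegral f : R[i] :=
  (\int[leb]_v complex.Re (f v)) +i* (\int[leb]_v complex.Im (f v)).

Definition weight mu v : R := `|v| `^ (2 * mu + 1).

Definition c_ mu : R := (2 `^ (mu + 1) * Gamma (mu + 1))^-1.

(* j_mu at real arguments, the only ones occurring below. *)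
Definition bessel_j mu x : R :=
  Gamma (mu + 1) *
  limn (series (fun n : nat =>
    (-1) ^+ n * (x / 2) ^+ (2 * n) / (n`!%:R * Gamma (n%:R + mu + 1)))).

(* [dunkl_kernel mu w v] is E_mu(i w, v): the first argument of E_mu is purely
   imaginary and is represented by its imaginary part. *)
Definition dunkl_kernel mu w v : R[i] :=
  bessel_j mu (w * v) +i*
  (w * v / (2 * (mu + 1)) * bessel_j (mu + 1) (w * v)).

Definition qpd_kernel a b c d e mu w v : R[i] :=
  expi (- (a * v ^+ 2 + c * w ^+ 2 + d * v + e * w)) *
  dunkl_kernel mu (- w / b) v.

Definition qpd_integral a b c d e mu f w : R[i] :=
  (c_ mu)%:C / cpow (0 +i* b) (mu + 1) *
  cintegral (fun v => qpd_kernel a b c d e mu w v * f v * (weight mu v)%:C).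

Definition Lp_norm mu (p : R) f : \bar R :=
  ((\int[leb]_v (complex.Re `|f v| `^ p * weight mu v)%:E) `^ p^-1)%E.

Definition in_Lp mu (p : R) f : Prop :=
  [/\ measurable_fun setT (fun v => complex.Re (f v)),
      measurable_fun setT (fun v => complex.Im (f v)) &
      (Lp_norm mu p f < +oo)%E].

Definition real_schwartz (h : R -> R) : Prop :=
  (forall (n : nat) x, derivable (derive1n n h) x 1) /\
  (forall m n : nat, exists M : R, forall x, `|x ^+ m * derive1n n h x| <= M).

Definition schwartz f : Prop :=
  real_schwartz (fun v => complex.Re (f v)) /\
  real_schwartz (fun v => complex.Im (f v)).

(* Elements of L^2_mu are handled through representatives, so that equalities
   between them hold almost everywhere; for mu >= -1/2 the measures dv and
   |v|^(2 mu + 1) dv have the same null sets.  The last two items are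
   continuity for the L^2_mu norm and agreement with the integral formula on
   the Schwartz space, which determine the operator uniquely. *)
Definition is_qpd_transform a b c d e mu
    (D : (R -> R[i]) -> (R -> R[i])) : Prop :=
  [/\ forall f, in_Lp mu 2 f -> in_Lp mu 2 (D f),
      forall (k : R[i]) f g, in_Lp mu 2 f -> in_Lp mu 2 g ->
        {ae leb, forall w, D (fun v => k * f v + g v) w = k * D f w + D g w},
      forall f, in_Lp mu 2 f -> forall eps : R, 0 < eps ->
        exists2 delta : R, 0 < delta &
          forall g, in_Lp mu 2 g ->
            (Lp_norm mu 2 (fun v => g v - f v)%R < delta%:E)%E ->
            (Lp_norm mu 2 (fun w => D g w - D f w)%R < eps%:E)%E &
      forall f, schwartz f ->
        {ae leb, forall w, D f w = qpd_integral a b c d e mu f w}].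

End QuadraticPhaseDunkl.

(* Main.v *)
Require Import Defs.
From mathcomp Require Import all_boot all_order all_algebra.
From mathcomp Require Import complex ring lra.
From mathcomp Require Import all_classical all_reals all_analysis.
From mathcomp Require Import measurable_realfun.
Set Implicit Arguments.
Unset Strict Implicit.
Unset Printing Implicit Defensive.
Import Order.TTheory GRing.Theory Num.Theory.
Import numFieldNormedType.Exports.
Local Open Scope classical_set_scope.
Local Open Scope ring_scope.
Local Open Scope complex_scope.

(** Up to chirps of modulus 1, the transform is the Dunkl transform taken at the frequency
    w / b. The proof rests on Gaussians, because the Dunkl transform sends Gaussians to
    Gaussians.

    Integrating the Bessel series term by term against [exp (- t v^2) |v|^(2 mu + 1)] produces
    the moments [Gamma (n + mu + 1)], which cancel the Gamma factors of the series and leave an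
    exponential series: the Hankel transform of [exp (- t v^2)] is a multiple of
    [exp (- y^2 / (4 t))] ([hankel_gauss]). The functions [v exp (- t v^2)] reduce to the same
    formula for [mu + 1], because [v^2 |v|^(2 mu + 1) = |v|^(2 (mu + 1) + 1)]. Now the inner
    products of the Gaussians [exp (- n v^2)] are explicit powers of [n + m], and those of their
    transforms are the same powers ([gpoly_parseval]), while even and odd functions are
    orthogonal on both sides ([Rint_even_odd_sqr]). Hence the transform preserves the norm of
    [exp (i (a v^2 + d v)) (P v + v Q v)], where P and Q are complex combinations of the
    [exp (- n v^2)] with n positive ([chirped_isometry]). These are Schwartz functions
    ([schwartz_chirp_gspan]), so that D is given by the integral formula on them.

    They are also dense ([gpoly_dense]). A square integrable function is close to a continuous
    one that vanishes near 0 and near infinity, which is the sum of an even function and of v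
    times an even function. An even continuous function with bounded support, divided by
    [exp (- v^2)], is a continuous function of [x = exp (- v^2)] on [[0, 1]], and polynomials in
    x approximate it uniformly ([weierstrass_approximation], [even_gpoly_approx]).

    By continuity, D preserves the norm of every square integrable function ([qpd_isometry]),
    and polarization with the factors 1 and - i yields the inner products ([qpd_rinner]). *)

(** * Moments of Gaussians and the Gamma function *)
Section gauss_moments.
Context {R : realType}.
Implicit Types (x s v t : R).
Local Notation leb := (@lebesgue_measure R).

Lemma continuous_powR x t : 0 < t -> {for t, continuous (@powR R ^~ x)}.
Proof.
move=> t0; apply/differentiable_continuous/derivable1_diffP.
by case: (is_derive1_powR x t0).
Qed.

Lemma continuous_expRN_sqr s : continuous (fun v : R => expR (- (s * v ^+ 2))).
Proof.
move=> v; apply: (@continuous_comp _ _ _ (fun x : R => - (s * x ^+ 2)) expR).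
  by apply: cvgN; apply: cvgM; [exact: cvg_cst|exact: exprn_continuous].
exact: continuous_expR.
Qed.

Lemma posreal_bigcup :
  `]0%R, +oo[%classic = \bigcup_n `[(n.+1%:R : R)^-1, n.+1%:R]%classic.
Proof.
apply/seteqP; split => x /=; rewrite in_itv /= andbT; last first.
  by case=> n _ /=; rewrite in_itv /= => /andP[h _]; apply: lt_le_trans h.
move=> x0; pose m := (Num.truncn x + Num.truncn x^-1)%N; exists m => //=.
rewrite in_itv /= invf_ple ?posrE//; apply/andP; split.
  rewrite (le_trans (ltW (truncnS_gt _)))// ler_nat ltnS leq_addl//.
rewrite (le_trans (ltW (truncnS_gt _)))// ler_nat ltnS leq_addr//.
Qed.

(** The substitution [v = sqrt (t / s)]. As [t `^ (x - 1)] may be singular at 0, it is made on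
    [[1/n, n]], before letting n grow. *)
Lemma gauss_subst x s : 0 < s ->
  (\int[leb]_(v in `]0%R, +oo[) (v `^ (2 * x - 1) * expR (- (s * v ^+ 2)))%:E =
  \int[leb]_(t in `]0%R, +oo[)
     ((s `^ (- x) / 2) * (t `^ (x - 1) * expR (- t)))%:E)%E.
Proof.
move=> s0.
pose k := s `^ (- 2^-1); pose F t := k * t `^ 2^-1.
have k0 : 0 < k by apply: powR_gt0.
have dF t : 0 < t -> is_derive t 1 F (k * (2^-1 * t `^ (2^-1 - 1))).
  by move=> t0; rewrite /F; apply: is_deriveZ; exact: is_derive1_powR.
have F'E t : 0 < t -> F^`()%classic t = k * (2^-1 * t `^ (2^-1 - 1)).
  by move=> t0; rewrite derive1E; case: (dF t t0).
have F'c t : 0 < t -> {for t, continuous F^`()%classic}.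
  move=> t0; have : {for t, continuous (fun u => k * (2^-1 * u `^ (2^-1 - 1)))}.
    apply: cvgM; first exact: cvg_cst.
    apply: cvgM; first exact: cvg_cst.
    exact: continuous_powR.
  rewrite /prop_for /continuous_at F'E//; apply: cvg_trans; apply: near_eq_cvg.
  by near=> u; rewrite F'E//; near: u; exact: lt_nbhsr.
have Fc t : 0 < t -> {for t, continuous F}.
  move=> t0; apply/differentiable_continuous/derivable1_diffP.
  by case: (dF t t0).
have F2 t : 0 <= t -> s * F t ^+ 2 = t.
  move=> t0; rewrite /F exprMn -!powR_mulrn ?powR_ge0// -!powRrM.
  rewrite mulNr mulVf// powRr1// powRN powRr1 ?ltW// mulrA divff ?mul1r//.
  by rewrite gt_eqF.
have F0 t : 0 <= F t by rewrite mulr_ge0 ?powR_ge0// ltW.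
have Fi v u : 0 <= v -> v <= u -> F v <= F u.
  move=> v0 vu; rewrite ler_pM2l// ge0_ler_powR// nnegrE//.
  exact: le_trans vu.
have FV v : 0 < v -> F (s * v ^+ 2) = v.
  move=> v0; apply/eqP; rewrite -(@eqrXn2 _ 2)// ?F0 ?ltW//.
  have := F2 (s * v ^+ 2); rewrite mulr_ge0 ?sqr_ge0 ?ltW// => /(_ isT).
  by move=> /mulfI; rewrite gt_eqF// => ->.
have cupE : `]0%R, +oo[%classic =
    \bigcup_n `[F (n.+1%:R)^-1, F n.+1%:R]%classic.
  apply/seteqP; split => v /=; rewrite in_itv /= andbT; last first.
    case=> n _ /=; rewrite in_itv /= => /andP[h _]; apply: lt_le_trans h.
    by rewrite mulr_gt0// powR_gt0// invr_gt0.
  move=> v0; have : `]0%R, +oo[%classic (s * v ^+ 2).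
    by rewrite /= in_itv/= andbT mulr_gt0// exprn_gt0.
  rewrite posreal_bigcup => -[n _ /=]; rewrite in_itv /= => /andP[h1 h2].
  exists n => //=; rewrite in_itv /= -(FV _ v0) !Fi//.
  by rewrite mulr_ge0 ?sqr_ge0// ltW.
rewrite [in LHS]cupE.
transitivity (limn (fun n => \int[leb]_(v in `[F (n.+1%:R)^-1%R, F (n.+1%:R)%R])
   (v `^ (2 * x - 1) * expR (- (s * v ^+ 2)))%:E)%E).
  apply/esym/cvg_lim => //.
  apply: ge0_nondecreasing_set_cvg_integral => //.
  - apply/nondecreasing_seqP => n; rewrite subsetEset => u /=.
    rewrite !in_itv /= => /andP[h1 h2]; apply/andP; split.
      apply: le_trans h1; apply: Fi => //.
      by rewrite lef_pV2 ?posrE// ler_nat.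
    by apply: le_trans h2 _; apply: Fi => //; rewrite ler_nat.
  - move=> n; apply/measurable_EFinP; apply: measurable_funM.
      apply: measurable_funTS; exact: measurable_powR.
    apply: measurable_funTS; apply: measurableT_comp => //.
    apply: measurableT_comp => //; apply: measurable_funM => //.
  - by move=> n v _; rewrite lee_fin mulr_ge0 ?powR_ge0 ?expR_ge0.
rewrite posreal_bigcup.
apply/cvg_lim => //.
have mI : measurable_fun setT (fun t : R => (s `^ (- x) / 2 * (t `^ (x - 1) * expR (- t)))%:E).
  apply/measurable_EFinP; apply: measurable_funM => //.
  apply: measurable_funM => //.
  apply: measurableT_comp => //.
pose g t := (s `^ (- x) / 2 * (t `^ (x - 1) * expR (- t)))%:E.
suff: (\int[leb]_(t in `[(n.+1%:R)^-1%R, (n.+1%:R)%R]) g t)%E @[n --> \oo] -->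
      (\int[leb]_(t in \bigcup_n `[(n.+1%:R : R)^-1%R, (n.+1%:R)%R]%classic) g t)%E.
  apply: cvg_trans; apply: near_eq_cvg; near=> n.
  have n0 : 0 < (n.+1%:R : R)^-1 by rewrite invr_gt0.
  have nn : (n.+1%:R : R)^-1 <= n.+1%:R.
    by rewrite (@le_trans _ _ 1)// ?ler1n// invf_le1// ler1n.
  have pos t : t \in `[(n.+1%:R)^-1, n.+1%:R] -> 0 < t.
    by rewrite in_itv /= => /andP[+ _]; exact: lt_le_trans.
  rewrite (@integration_by_substitution_increasing _ F)//.
  - apply: eq_integral => t; rewrite inE /= => /pos t0; congr EFin.
    rewrite !fctE /= F'E// F2 ?ltW//.
    rewrite /F powRM ?powR_ge0// /k -!powRrM.
    have -> : t `^ (x - 1) = t `^ (2^-1 * (2 * x - 1)) * t `^ (2^-1 - 1).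
      rewrite -powRD; last by rewrite (gt_eqF t0) implybT.
      by congr (_ `^ _); field.
    have -> : s `^ (- x) = s `^ (- 2^-1 * (2 * x - 1)) * s `^ (- 2^-1).
      rewrite -powRD; last by rewrite (gt_eqF s0) implybT.
      by congr (_ `^ _); field.
    ring.
  - move=> u v /pos u0 /pos v0 uv; rewrite /F ltr_pM2l// gt0_ltr_powR// nnegrE ltW//.
  - move=> t /subset_itv_oo_cc /pos; exact: F'c.
  - apply: cvgP; apply: cvg_at_right_filter; exact: F'c.
  - apply: cvgP; apply: cvg_at_left_filter; apply: F'c; exact: lt_le_trans nn.
  - split => /=.
    + move=> t /subset_itv_oo_cc/pos t0; by case: (dF t t0).
    + apply: cvg_at_right_filter; exact: Fc.
    + apply: cvg_at_left_filter; apply: Fc; exact: lt_le_trans nn.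
  - have gt0 : 0 < F n.+1%:R^-1 by rewrite mulr_gt0// powR_gt0.
    apply: continuous_in_subspaceT => u; rewrite inE /= in_itv /= => /andP[h _].
    have u0 : 0 < u by exact: lt_le_trans h.
    apply: cvgM; first exact: continuous_powR.
      exact: continuous_expRN_sqr.
apply: ge0_nondecreasing_set_cvg_integral => //.
- apply/nondecreasing_seqP => n; rewrite subsetEset => u /=.
  rewrite !in_itv /= => /andP[h1 h2]; apply/andP; split.
    apply: le_trans h1; by rewrite lef_pV2 ?posrE// ler_nat.
  by apply: le_trans h2 _; rewrite ler_nat.
- by move=> n; apply: measurable_funTS.
- move=> n t _; rewrite lee_fin; apply: mulr_ge0.
    by rewrite divr_ge0// powR_ge0.
  by rewrite mulr_ge0 ?powR_ge0 ?expR_ge0.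
Unshelve. all: by end_near. Qed.


Lemma ge0_integral_even (f : R -> \bar R) : measurable_fun setT f ->
  (forall v, 0 <= f v)%E -> (forall v, f (- v) = f v) ->
  (\int[leb]_v f v = 2%:E * \int[leb]_(v in `]0%R, +oo[) f v)%E.
Proof.
move=> mf f0 fe.
rewrite -{1}setC0 -(set_itvoc0 0%R) setCitv /= ge0_integral_setU//=; last 2 first.
  by apply: measurable_funTS.
  rewrite disj_set2E; apply/eqP; rewrite -subset0 => x []/= /[!in_itv]/=.
  by rewrite leNgt andbT => /negP.
have -> : (\int[leb]_(v in `]-oo, 0%R]) f v = \int[leb]_(v in `]0%R, +oo[) f v)%E.
  under eq_integral do rewrite -fe.
  rewrite -ge0_integration_by_substitution0// -integral_itv_obnd_cbnd//.
  exact: measurable_funTS.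
by rewrite mule_natl mule2n.
Qed.

(** The integral in [Gamma], kept in [\bar R]: changes of variables hold there for all nonnegative
    functions, and finiteness is a separate matter, settled in [eGamma_fin]. *)
Definition eGamma x := (\int[leb]_(t in `]0%R, +oo[) (t `^ (x - 1) * expR (- t))%:E)%E.

Lemma measurable_gauss_moment x s :
  measurable_fun setT (fun v : R => `|v| `^ (2 * x - 1) * expR (- (s * v ^+ 2))).
Proof.
apply: measurable_funM.
  apply: (@measurableT_comp _ _ _ _ _ _ (@powR R ^~ (2 * x - 1))) => //.
exact: continuous_measurable_fun (@continuous_expRN_sqr s).
Qed.

Lemma eGamma_ge0 x : (0 <= eGamma x)%E.
Proof. by apply: integral_ge0 => t _; rewrite lee_fin mulr_ge0 ?powR_ge0 ?expR_ge0. Qed.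

Lemma gauss_eGamma x s : 0 < s ->
  (\int[leb]_v (`|v| `^ (2 * x - 1) * expR (- (s * v ^+ 2)))%:E =
  (s `^ (- x))%:E * eGamma x)%E.
Proof.
move=> s0; rewrite ge0_integral_even; last 3 first.
- by apply/measurable_EFinP; exact: measurable_gauss_moment.
- by move=> v; rewrite lee_fin mulr_ge0 ?powR_ge0 ?expR_ge0.
- by move=> v; rewrite normrN sqrrN.
have -> : (\int[leb]_(v in `]0%R, +oo[) (`|v| `^ (2 * x - 1) * expR (- (s * v ^+ 2)))%:E =
    \int[leb]_(v in `]0%R, +oo[) (v `^ (2 * x - 1) * expR (- (s * v ^+ 2)))%:E)%E.
  apply: eq_integral => v; rewrite inE /= in_itv /= andbT => v0.
  by rewrite gtr0_norm.
rewrite gauss_subst//.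
under eq_integral do rewrite EFinM.
rewrite ge0_integralZl_EFin//; last 3 first.
- by move=> t _; rewrite lee_fin mulr_ge0 ?powR_ge0 ?expR_ge0.
- apply/measurable_EFinP; apply: measurable_funTS; apply: measurable_funM => //.
  exact: measurableT_comp.
- by rewrite divr_ge0 ?powR_ge0.
by rewrite muleA -EFinM mulrCA divff ?mulr1.
Qed.

Lemma powR_le_expR x : 2^-1 <= x -> exists2 C, 0 < C &
  forall v, `|v| `^ (2 * x - 1) <= C * expR (v ^+ 2).
Proof.
move=> x12; pose n := (Num.truncn (2 * x - 1)).+1.
exists n`!%:R => [|{}v]; first by rewrite ltr0n fact_gt0.
have e1 : 1 <= expR (v ^+ 2) by rewrite -expR0 ler_expR sqr_ge0.
have f1 : 1 <= n`!%:R :> R by rewrite ler1n fact_gt0.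
have p0 : 0 <= 2 * x - 1 by lra.
have [v1|v1] := leP `|v| 1.
  apply: (@le_trans _ _ 1); last by rewrite mulr_ege1.
  rewrite [leRHS](_ : 1 = 1 `^ (2 * x - 1)); last by rewrite powR1.
  by rewrite ge0_ler_powR ?nnegrE.
apply: (@le_trans _ _ (`|v| `^ n%:R)).
  by rewrite ler_powR ?(ltW v1)// ltW// truncnS_gt.
rewrite powR_mulrn//; apply: (@le_trans _ _ (v ^+ 2 ^+ n)).
  rewrite -(@real_normK _ v)// ?num_real// -exprM mulnC exprM.
  by rewrite expr2 ler_peMl ?exprn_ge0// exprn_ege1// ltW.
have := @expR_ge1Dxn R (v ^+ 2) n.-1 (sqr_ge0 _).
rewrite prednK// => h; rewrite mulrC -ler_pdivrMr; last by lra.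
by apply: le_trans h; rewrite lerDr.
Qed.

(** The moment at [s = 2] is dominated by the Gauss integral. *)
Lemma eGamma_fin x : 2^-1 <= x -> (eGamma x < +oo)%E.
Proof.
move=> x12; have [C C0 hC] := powR_le_expR x12.
have : (\int[leb]_v (`|v| `^ (2 * x - 1) * expR (- (2 * v ^+ 2)))%:E < +oo)%E.
  apply: (@le_lt_trans _ _ (\int[leb]_v (C * gauss_fun v)%:E)%E).
    apply: ge0_le_integral => //=.
    - by apply/measurable_EFinP; exact: measurable_gauss_moment.
    - apply/measurable_EFinP; apply: measurable_funM => //.
      exact: measurable_gauss_fun.
    - move=> v _; rewrite lee_fin /gauss_fun.
      have -> : - (2 * v ^+ 2) = - v ^+ 2 - v ^+ 2 by ring.
      rewrite expRD mulrA ler_pM2r ?expR_gt0//.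
      by rewrite expRN ler_pdivrMr ?expR_gt0.
  apply: integrable_lty => //.
  have := integrableZl measurableT C (@integrableT_gauss R).
  by apply: eq_integrable => // v _.
rewrite gauss_eGamma//; have := eGamma_ge0 x.
case: (eGamma x) => //=.
  by move=> r _ _; rewrite ltry.
by rewrite gt0_muley// lte_fin powR_gt0.
Qed.

Lemma eGammaE x : 2^-1 <= x -> eGamma x = (Gamma x)%:E.
Proof.
move=> /eGamma_fin h; rewrite /Gamma /Rintegral fineK//.
by rewrite ge0_fin_numE// eGamma_ge0.
Qed.

#[local] Opaque Gamma.

Lemma gauss_moment_integrable x s : 2^-1 <= x -> 0 < s ->
  leb.-integrable setT (fun v : R => (`|v| `^ (2 * x - 1) * expR (- (s * v ^+ 2)))%:E).
Proof.
move=> x12 s0; apply/integrableP; split.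
  by apply/measurable_EFinP; exact: measurable_gauss_moment.
under eq_integral do rewrite gee0_abs ?lee_fin ?mulr_ge0 ?powR_ge0 ?expR_ge0//.
by rewrite gauss_eGamma// eGammaE// -EFinM ltry.
Qed.

Lemma gauss_moment x s : 2^-1 <= x -> 0 < s ->
  \int[leb]_v (`|v| `^ (2 * x - 1) * expR (- (s * v ^+ 2))) = Gamma x * s `^ (- x).
Proof. by move=> x12 s0; rewrite /Rintegral gauss_eGamma// eGammaE//= mulrC. Qed.

Lemma sqr_powR_norm x v : 2^-1 <= x ->
  v ^+ 2 * `|v| `^ (2 * x - 1) = `|v| `^ (2 * (x + 1) - 1).
Proof.
move=> x12; have [->|v0] := eqVneq v 0.
  rewrite expr0n mul0r normr0 powR0//; apply/eqP => h; lra.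
have -> : 2 * (x + 1) - 1 = 2%:R + (2 * x - 1) by ring.
rewrite [RHS]powRD; last by rewrite normr_eq0 v0 implybT.
by rewrite powR_mulrn// real_normK// num_real.
Qed.

Lemma Gamma_gt0 x : 2^-1 <= x -> 0 < Gamma x.
Proof.
move=> x12; rewrite -lte_fin -eGammaE//.
have := @gauss_eGamma x 1 ltr01; rewrite powR1 mul1e => <-.
apply: (@lt_le_trans _ _ (\int[leb]_(v in `[1%R, 2%R]) (expR (-4))%:E)%E).
  rewrite integral_cst//= lebesgue_measure_itv /= lte_fin ltr1n.
  rewrite -EFinB -EFinM lte_fin mulr_gt0 ?expR_gt0//; lra.
apply: (@le_trans _ _ (\int[leb]_(v in `[1%R, 2%R])
  (`|v| `^ (2 * x - 1) * expR (- (1 * v ^+ 2)))%:E)%E).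
  apply: ge0_le_integral => //=.
  - apply/measurable_EFinP; apply: measurable_funTS.
    exact: measurable_gauss_moment.
  - move=> v; rewrite in_itv /= => /andP[v1 v2]; rewrite lee_fin.
    rewrite -[leLHS]mul1r ler_pM ?expR_ge0//.
      have v0 : 0 <= (v : R) := le_trans ler01 v1.
      by rewrite -[leLHS](powRr0 `|v|) ler_powR ?ger0_norm//; lra.
    by rewrite ler_expR; nra.
apply: ge0_subset_integral => //=.
by apply/measurable_EFinP; exact: measurable_gauss_moment.
Qed.

(** Integrating [exp y >= 1 + y] at [y = (1 - s) v ^ 2] against the weight [exp (- v ^ 2)] says
    that [s |-> Gamma x * s ^ (- x) + s * Gamma (x + 1)] is minimal at [s = 1], where its
    derivative [Gamma (x + 1) - x * Gamma x] must therefore vanish. *)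
Lemma GammaS x : 2^-1 <= x -> Gamma (x + 1) = x * Gamma x.
Proof.
move=> x12; have x12' : 2^-1 <= x + 1 by lra.
pose m s v := `|v| `^ (2 * x - 1) * expR (- (s * v ^+ 2)).
pose m' v := `|v| `^ (2 * (x + 1) - 1) * expR (- (1 * v ^+ 2)).
have le_m s v : m 1 v + 1 * m' v <= m s v + s * m' v.
  rewrite /m /m' -sqr_powR_norm//; move: (powR_ge0 `|v| (2 * x - 1)).
  set P := _ `^ _ => P0.
  have := expR_ge1Dx ((1 - s) * v ^+ 2); have := expR_gt0 (- (1 * v ^+ 2)).
  have -> : - (s * v ^+ 2) = (1 - s) * v ^+ 2 + - (1 * v ^+ 2) by ring.
  rewrite expRD; set E := expR (- _); set E' := expR _ => E0 hE.
  rewrite -subr_ge0 [leRHS](_ : _ = P * E * (E' - (1 + (1 - s) * v ^+ 2))); last by ring.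
  by rewrite mulr_ge0 ?subr_ge0// mulr_ge0// ltW.
have im s : 0 < s -> leb.-integrable setT (EFin \o m s).
  by move=> s0; exact: gauss_moment_integrable.
have im' : leb.-integrable setT (EFin \o m') by exact: gauss_moment_integrable.
have iZ s : leb.-integrable setT (EFin \o (fun v => s * m' v)).
  by have := integrableZl measurableT s im'; apply: eq_integrable.
have iD s : 0 < s -> leb.-integrable setT (EFin \o (fun v => m s v + s * m' v)).
  by move=> s0; have := integrableD measurableT (im s s0) (iZ s); apply: eq_integrable.
pose phi s := Gamma x * s `^ (- x) + s * Gamma (x + 1).
have phiE s : 0 < s -> phi s = \int[leb]_v (m s v + s * m' v).
  move=> s0; rewrite (RintegralD measurableT (im s s0) (iZ s)).
  rewrite (RintegralZl s measurableT im') (gauss_moment x12 s0).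
  by rewrite (gauss_moment x12' ltr01) powR1 mulr1.
have phi_min s : 0 < s -> phi 1 <= phi s.
  move=> s0; rewrite (phiE 1 ltr01) (phiE s s0).
  exact: (le_Rintegral measurableT (iD 1 ltr01) (iD s s0) (fun v _ => le_m s v)).
have dphi s : 0 < s ->
    is_derive s 1 phi (Gamma x * (- x * s `^ (- x - 1)) + Gamma (x + 1)).
  move=> s0; have d1 := is_deriveZ (Gamma x) (is_derive1_powR (- x) s0).
  have := is_deriveD d1 (is_deriveZ (Gamma (x + 1)) (is_derive_id s 1)).
  rewrite (_ : _ + _ = phi); last first.
    by apply/funext => r; rewrite /phi !fctE [r * _]mulrC.
  by move=> H; apply: is_derive_eq H _; rewrite /GRing.scale /= mulr1.
have itv0 s : s \in `]0, 2[ -> 0 < s by rewrite in_itv => /andP[].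
have [|||_ phi0] := @derive1_at_min R phi 0 2 1 (ler0n R 2).
- by move=> s /itv0 /dphi [].
- by rewrite in_itv /= ltr01 ltr1n.
- by move=> s /itv0; exact: phi_min.
case: (dphi 1 ltr01) => _; rewrite phi0 powR1 mulr1; lra.
Qed.

End gauss_moments.

(** * Integrals of real functions *)
Section real_integrable.
Context {R : realType}.
Implicit Types (f g : R -> R) (k : R).
Local Notation leb := (@lebesgue_measure R).
Local Notation L1 f := (leb.-integrable setT (EFin \o f)).

Lemma eq_L1 f g : f =1 g -> L1 f -> L1 g.
Proof. by move=> fg; apply: eq_integrable => // v _ /=; rewrite fg. Qed.

Lemma L1D f g : L1 f -> L1 g -> L1 (fun v => f v + g v).
Proof. by move=> f1 g1; have := integrableD measurableT f1 g1; apply: eq_integrable. Qed.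

Lemma L1B f g : L1 f -> L1 g -> L1 (fun v => f v - g v).
Proof. by move=> f1 g1; have := integrableB measurableT f1 g1; apply: eq_integrable. Qed.

Lemma L1Z k f : L1 f -> L1 (fun v => k * f v).
Proof. by move=> f1; have := integrableZl measurableT k f1; apply: eq_integrable. Qed.

Lemma L1_sum n (h : 'I_n -> R -> R) : (forall i, L1 (h i)) ->
  L1 (fun v => \sum_(i < n) h i v).
Proof.
move=> hi; have := @integrable_sum _ _ _ leb _ measurableT _ (index_enum 'I_n)
  xpredT (fun i => EFin \o h i) (fun i _ => hi i).
by apply: eq_integrable => // v _ /=; rewrite sumEFin.
Qed.

Lemma Rint_sum n (h : 'I_n -> R -> R) : (forall i, L1 (h i)) ->
  \int[leb]_v (\sum_(i < n) h i v) = \sum_(i < n) \int[leb]_v (h i v).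
Proof.
elim: n h => [|n IH] h hi.
  rewrite big_ord0; under eq_Rintegral do rewrite big_ord0.
  by rewrite /Rintegral integral0.
under eq_Rintegral do rewrite big_ord_recl.
rewrite RintegralD//; last by apply: L1_sum.
by rewrite big_ord_recl IH.
Qed.

Lemma ge0_integral_reflect (f : R -> \bar R) : measurable_fun setT f ->
  (forall v, 0 <= f v)%E -> (\int[leb]_v f (- v)%R = \int[leb]_v f v)%E.
Proof.
move=> mf f0.
transitivity (\int[leb]_(v in (-%R : _ -> measurableTypeR R) @^-1` setT)
   (f \o (-%R : _ -> measurableTypeR R)) v)%E; first by [].
rewrite -ge0_integral_pushforward//=.
by apply: eq_measure_integral => //= A mA _; exact: lebesgue_measureN.
Qed.

(** The positive and the negative part are reflections of one another. *)
Lemma Rint_odd f : measurable_fun setT f -> (forall v, f (- v) = - f v) ->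
  \int[leb]_v f v = 0.
Proof.
move=> mf fo; rewrite /Rintegral integralE.
suff -> : (\int[leb]_v (fun v => (f v)%:E)^\- v = \int[leb]_v (fun v => (f v)%:E)^\+ v)%E.
  have : (0 <= \int[leb]_v (fun v => (f v)%:E)^\+ v)%E by exact: integral_ge0.
  by case: (integral _ _ _) => //= r _; rewrite subrr.
have e v : ((fun v => (f v)%:E)^\- v = (fun v => (f v)%:E)^\+ (- v)%R)%E.
  by rewrite funenegE funeposE fo.
have mp : measurable_fun setT (fun v => (f v)%:E)^\+%E.
  by apply: measurable_funepos; exact/measurable_EFinP.
under eq_integral do rewrite e.
exact: ge0_integral_reflect.
Qed.

(** Dominated convergence: the sum of the [`|u n|], which is integrable, dominates the partial
    sums. *)
Lemma Rint_series (u : nat -> R -> R) (U : R -> R) (M : R^nat) :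
  (forall n, L1 (u n)) ->
  (forall n, \int[leb]_v `|u n v| <= M n) -> cvgn (series M) ->
  (forall v, series (u^~ v) @ \oo --> U v) ->
  L1 U /\ series (fun n => \int[leb]_v u n v) @ \oo --> \int[leb]_v U v.
Proof.
move=> iu uM cM uU.
have mu_ n : measurable_fun setT (u n).
  by apply/measurable_EFinP; exact: measurable_int (iu n).
have M0 n : 0 <= M n by apply: le_trans (uM n); apply: Rintegral_ge0.
pose g v := (\sum_(0 <= n <oo) `|(u n v)%:E|)%E.
have ig : leb.-integrable setT g.
  apply/integrableP; split.
    by apply: (@ge0_emeasurable_sum _ _ _ _ (fun n v => `|(u n v)%:E|%E) xpredT) => // n _;
    apply/measurable_EFinP; exact: measurableT_comp.
  under eq_integral do rewrite gee0_abs ?nneseries_ge0//.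
  rewrite integral_nneseries//; last first.
    by move=> n; apply/measurable_EFinP;
    exact: (measurableT_comp (@normr_measurable R setT) (mu_ n)).
  apply: (@le_lt_trans _ _ (\sum_(0 <= n <oo) (M n)%:E)%E).
    apply: lee_nneseries => [n _ _|n _]; first exact: integral_ge0.
    have := uM n; rewrite -lee_fin /Rintegral fineK//.
    exact: integrable_fin_num (integrable_norm (iu n)).
  have -> : (\sum_(0 <= n <oo) (M n)%:E)%E = (limn (series M))%:E.
    by rewrite -EFin_lim//; congr (limn _); apply/funext => n /=; rewrite sumEFin.
  exact: ltry.
have mU : measurable_fun setT U.
  apply: (measurable_fun_cvg _ (fun v _ => uU v)) => n.
  by apply: measurable_sum => i; exact: mu_.
have [] := @dominated_convergence _ _ _ leb _ measurableT
   (fun n v => (series (u^~ v) n)%:E) (EFin \o U) g.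
- move=> n; apply/measurable_EFinP.
  by apply: measurable_sum => i; exact: mu_.
- exact/measurable_EFinP.
- by apply: aeW => v _; apply: cvg_EFin; [exact: nearW|exact: uU].
- exact: ig.
- apply: aeW => v n _; rewrite /series /=.
  apply: le_trans (nneseries_lim_ge n _) => //.
  by rewrite sumEFin lee_fin ler_norm_sum.
move=> iU _ H; split => //.
have intU := integrable_fin_num measurableT iU.
rewrite /Rintegral; move: H; rewrite -(fineK intU) => /fine_cvg.
rewrite fineK//; apply: cvg_trans; apply: near_eq_cvg; near=> n.
rewrite /= /series /= -[LHS]/(\int[leb]_v (\sum_(0 <= k < n) u k v)).
rewrite big_mkord -Rint_sum//.
by under eq_Rintegral do rewrite big_mkord.
Unshelve. all: by end_near. Qed.

End real_integrable.

(** * The Hankel transform of a Gaussian *)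
Section hankel.
Context {R : realType}.
Implicit Types (mu s t v y : R).
Local Notation leb := (@lebesgue_measure R).
Local Notation L1 f := (leb.-integrable setT (EFin \o f)).

#[local] Opaque Gamma.

Lemma ge_half_mu mu n : - (1 / 2) <= mu -> 2^-1 <= mu + n%:R + 1.
Proof. by move=> hmu; have : 0 <= n%:R :> R by []; lra. Qed.

Lemma weightE mu v : weight mu v = `|v| `^ (2 * (mu + 1) - 1).
Proof. by rewrite /weight; congr (_ `^ _); ring. Qed.

Lemma weight_ge0 mu v : 0 <= weight mu v.
Proof. exact: powR_ge0. Qed.

Lemma weightN mu v : weight mu (- v) = weight mu v.
Proof. by rewrite /weight normrN. Qed.

Lemma measurable_weight mu : measurable_fun setT (weight mu).
Proof. by apply: (@measurableT_comp _ _ _ _ _ _ (@powR R ^~ (2 * mu + 1))). Qed.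

Lemma sqr_weight mu v : - (1 / 2) <= mu -> v ^+ 2 * weight mu v = weight (mu + 1) v.
Proof. by move=> hmu; rewrite !weightE sqr_powR_norm//; lra. Qed.

Lemma exprn_weight mu n v : - (1 / 2) <= mu ->
  v ^+ (2 * n) * weight mu v = weight (mu + n%:R) v.
Proof.
move=> hmu; elim: n => [|n IH]; first by rewrite muln0 expr0 mul1r addr0.
have n0 : 0 <= n%:R :> R by [].
by rewrite mulnS exprD -mulrA IH sqr_weight; [rewrite -addrA natr1|lra].
Qed.

Lemma gauss_weight_L1 mu s : - (1 / 2) <= mu -> 0 < s ->
  L1 (fun v => expR (- (s * v ^+ 2)) * weight mu v).
Proof.
move=> hmu s0; have x12 : 2^-1 <= mu + 1 by lra.
apply: eq_L1 (gauss_moment_integrable x12 s0).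
by move=> v; rewrite weightE mulrC.
Qed.

Lemma Rint_gauss_weight mu s : - (1 / 2) <= mu -> 0 < s ->
  \int[leb]_v (expR (- (s * v ^+ 2)) * weight mu v) = Gamma (mu + 1) * s `^ (- (mu + 1)).
Proof.
move=> hmu s0; rewrite -gauss_moment//; last by lra.
by apply: eq_Rintegral => v _; rewrite weightE mulrC.
Qed.

Lemma Gamma_geometric mu n : - (1 / 2) <= mu ->
  Gamma (mu + 1) <= 2 ^+ n * Gamma (n%:R + mu + 1).
Proof.
move=> hmu; elim: n => [|n IH]; first by rewrite expr0 mul1r add0r.
have h := @ge_half_mu mu n hmu; rewrite (addrC mu) in h.
have -> : n.+1%:R + mu + 1 = (n%:R + mu + 1) + 1 :> R by rewrite -natr1; ring.
rewrite (GammaS h); apply: le_trans IH _.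
rewrite exprS -mulrA mulrCA ler_wpM2l ?exprn_ge0// mulrA ler_peMl//.
  exact: ltW (Gamma_gt0 h).
lra.
Qed.

Definition bessel_term mu x (n : nat) : R :=
  (-1) ^+ n * (x / 2) ^+ (2 * n) / (n`!%:R * Gamma (n%:R + mu + 1)).

Lemma Gamma_nat_gt0 mu n : - (1 / 2) <= mu -> 0 < Gamma (n%:R + mu + 1).
Proof. by move=> hmu; apply: Gamma_gt0; rewrite (addrC n%:R) ge_half_mu. Qed.

(** By [Gamma_geometric], comparison with the exponential series at [x ^ 2 / 2]. *)
Lemma bessel_term_cvg mu x : - (1 / 2) <= mu -> cvgn (series (bessel_term mu x)).
Proof.
move=> hmu; apply: normed_cvg.
pose k := (Gamma (mu + 1))^-1.
have G0 : 0 < Gamma (mu + 1) by apply: Gamma_gt0; lra.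
apply: (@series_le_cvg _ _ (k *: exp_coeff (x ^+ 2 / 2))).
- by move=> n; exact: normr_ge0.
- move=> n; apply: mulr_ge0; first by rewrite invr_ge0 ltW.
  by rewrite exp_coeff_ge0// mulr_ge0// sqr_ge0.
- move=> n /=; rewrite /bessel_term normrM normrM normrX normrN1 expr1n mul1r.
  rewrite normrX normfV (ger0_norm (ltW (mulr_gt0 _ (Gamma_nat_gt0 n hmu))))//.
  rewrite exprM real_normK ?num_real// /exp_coeff /= /k.
  have := Gamma_geometric n hmu; have := Gamma_nat_gt0 n hmu.
  set g := Gamma (_ + _ + _) => g0 hg.
  rewrite [leRHS](_ : _ = (x ^+ 2 / 2) ^+ n / n`!%:R / Gamma (mu + 1)); last first.
    exact: (mulrC (Gamma (mu + 1))^-1).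
  rewrite invfM mulrA.
  rewrite ler_pdivrMr// mulrAC ler_pdivlMr//.
  have -> : (x / 2) ^+ 2 = x ^+ 2 / 2 / 2 by field.
  set w := x ^+ 2 / 2.
  have -> : (w / 2) ^+ n / n`!%:R * Gamma (mu + 1) =
      (w ^+ n / n`!%:R) * ((2 ^+ n)^-1 * Gamma (mu + 1)).
    by rewrite exprMn exprVn; ring.
  rewrite ler_wpM2l ?ler_pdivrMl ?exprn_gt0//.
  by rewrite divr_ge0// exprn_ge0// divr_ge0// sqr_ge0.
- by apply: is_cvg_seriesZ; exact: is_cvg_series_exp_coeff.
Qed.

Lemma bessel_jE mu x : bessel_j mu x = Gamma (mu + 1) * limn (series (bessel_term mu x)).
Proof. by []. Qed.

Lemma bessel_jN mu x : bessel_j mu (- x) = bessel_j mu x.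
Proof.
rewrite !bessel_jE; suff -> : bessel_term mu (- x) = bessel_term mu x by [].
apply/funext => n.
by rewrite /bessel_term mulNr exprM sqrrN -exprM.
Qed.

(** The Hankel transform of a Gaussian is a Gaussian: the moments cancel the
    Gamma factors of the Bessel series, leaving an exponential series. *)
Lemma hankel_gauss mu t y : - (1 / 2) <= mu -> 0 < t ->
  L1 (fun v => bessel_j mu (y * v) * (expR (- (t * v ^+ 2)) * weight mu v)) /\
  \int[leb]_v (bessel_j mu (y * v) * (expR (- (t * v ^+ 2)) * weight mu v)) =
  Gamma (mu + 1) * t `^ (- (mu + 1)) * expR (- (y ^+ 2 / (4 * t))).
Proof.
move=> hmu t0.
pose G := Gamma (mu + 1).
have G0 : 0 < G by apply: Gamma_gt0; lra.
pose c n := G * ((-1) ^+ n * (y / 2) ^+ (2 * n) / (n`!%:R * Gamma (n%:R + mu + 1))).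
pose u n v := c n * (expR (- (t * v ^+ 2)) * weight (mu + n%:R) v).
pose z := y ^+ 2 / (4 * t).
pose K := G * t `^ (- (mu + 1)).
have hmun n : - (1 / 2) <= mu + n%:R by have : 0 <= n%:R :> R by []; lra.
have iu n : L1 (u n) by apply: L1Z; exact: gauss_weight_L1.
have Gn n : \int[leb]_v (expR (- (t * v ^+ 2)) * weight (mu + n%:R) v) =
    Gamma (n%:R + mu + 1) * (t `^ (- (mu + 1)) / t ^+ n).
  rewrite Rint_gauss_weight// (addrC mu); congr (_ * _).
  have -> : - (n%:R + mu + 1) = - (mu + 1) + - n%:R by ring.
  rewrite powRD; last by rewrite (gt_eqF t0) implybT.
  by rewrite powR_invn// ltW.
have zE n : z ^+ n = (y / 2) ^+ (2 * n) / t ^+ n.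
  by rewrite exprM -exprVn -exprMn /z; congr (_ ^+ _); field; rewrite gt_eqF.
have intu n : \int[leb]_v (u n v) = K * exp_coeff (- z) n.
  rewrite RintegralZl//; last exact: gauss_weight_L1.
  rewrite Gn /c /exp_coeff /= (_ : (- z) ^+ n = (-1) ^+ n * z ^+ n); last by rewrite -exprMn mulN1r.
  rewrite zE /K; field.
  by rewrite !gt_eqF ?Gamma_nat_gt0 ?ltr0n ?fact_gt0 ?exprn_gt0.
have intau n : \int[leb]_v `|u n v| = K * exp_coeff z n.
  have -> : \int[leb]_v `|u n v| =
      \int[leb]_v (`|c n| * (expR (- (t * v ^+ 2)) * weight (mu + n%:R) v)).
    apply: eq_Rintegral => v _; rewrite normrM; congr (_ * _).
    by rewrite ger0_norm// mulr_ge0 ?expR_ge0 ?weight_ge0.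
  rewrite RintegralZl//; last exact: gauss_weight_L1.
  rewrite Gn /c /exp_coeff /= zE /K.
  rewrite !normrM normrX normrN1 expr1n mul1r (gtr0_norm G0) normrX normfV.
  rewrite (gtr0_norm (mulr_gt0 _ (Gamma_nat_gt0 n hmu))) ?ltr0n ?fact_gt0//.
  rewrite [`|y / 2| ^+ _]exprM real_normK ?num_real// -exprM.
  field.
  by rewrite !gt_eqF ?Gamma_nat_gt0 ?ltr0n ?fact_gt0 ?exprn_gt0.
have uE v : series (u^~ v) @ \oo -->
    bessel_j mu (y * v) * (expR (- (t * v ^+ 2)) * weight mu v).
  have -> : u^~ v = fun n =>
      (G * (expR (- (t * v ^+ 2)) * weight mu v)) *: bessel_term mu (y * v) n.
    apply/funext => n; rewrite /u -exprn_weight// /c /bessel_term.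
    have -> : y * v / 2 = y / 2 * v by ring.
    rewrite [(_ * v) ^+ _]exprMn /GRing.scale /=; ring.
  rewrite bessel_jE.
  have -> : G * limn (series (bessel_term mu (y * v))) * (expR (- (t * v ^+ 2)) * weight mu v) =
    (G * (expR (- (t * v ^+ 2)) * weight mu v)) *: limn (series (bessel_term mu (y * v))).
    by rewrite /GRing.scale /=; ring.
  rewrite (_ : series _ = (G * (expR (- (t * v ^+ 2)) * weight mu v)) *:
    series (bessel_term mu (y * v))); last first.
    by apply/funext => n; rewrite /series /= -scaler_sumr.
  by apply: cvgZr; exact: bessel_term_cvg.
have cM : cvgn (series (fun n => K * exp_coeff z n)).
  by apply: (@is_cvg_seriesZ _ _ K); exact: is_cvg_series_exp_coeff.
have [|iU H] := Rint_series iu _ cM uE; first by move=> n; rewrite intau.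
split => //; apply: (cvg_unique _ H) => //.
rewrite (_ : (fun n => _) = (fun n => K *: exp_coeff (- z) n)); last first.
  by apply/funext => n; rewrite intu.
rewrite (_ : series _ = K *: series (exp_coeff (- z))); last first.
  by apply/funext => n; rewrite /series /= -scaler_sumr.
by apply: cvgZr; exact: is_cvg_series_exp_coeff.
Qed.

End hankel.

(** * Finite sums of Gaussians *)
Section gauss_sums.
Context {R : realType}.
Implicit Types (mu t v w y b : R) (c s : nat -> R).
Local Notation leb := (@lebesgue_measure R).
Local Notation L1 f := (leb.-integrable setT (EFin \o f)).

#[local] Opaque Gamma.

(** With equality for [mu = - 1/2], where the Bessel function is the cosine. *)
Lemma fact_Gamma_le mu n : - (1 / 2) <= mu ->
  ((2 * n)`!)%:R * Gamma (mu + 1) <= 4 ^+ n * n`!%:R * Gamma (n%:R + mu + 1).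
Proof.
move=> hmu; elim: n => [|n IH]; first by rewrite muln0 expr0 fact0 !mul1r add0r.
have h := @ge_half_mu R mu n hmu; rewrite (addrC mu) in h.
have -> : n.+1%:R + mu + 1 = (n%:R + mu + 1) + 1 :> R by rewrite -natr1; ring.
rewrite (GammaS h) mulnS addSn addSn add0n !factS !natrM.
set g := Gamma (_ + _ + 1) in IH *; set g1 := Gamma (mu + 1) in IH *.
set F := (2 * n)`!%:R in IH *; set f := n`!%:R in IH *.
have n0 : 0 <= n%:R :> R by [].
have -> : n.+1%:R = n%:R + 1 :> R by rewrite natr1.
have -> : (2 * n).+1%:R = 2 * n%:R + 1 :> R by rewrite -natr1 natrM.
have -> : (2 * n).+2%:R = 2 * n%:R + 1 + 1 :> R by rewrite -addn2 natrD natrM; ring.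
rewrite exprS.
have -> : (2 * n%:R + 1 + 1) * ((2 * n%:R + 1) * F) * g1 =
  ((2 * n%:R + 2) * (2 * n%:R + 1)) * (F * g1) :> R by ring.
have -> : 4 * 4 ^+ n * ((n%:R + 1) * f) * ((n%:R + mu + 1) * g) =
  (2 * (n%:R + 1)) * (2 * (n%:R + mu + 1)) * (4 ^+ n * f * g) :> R by ring.
have p1 : 0 <= F * g1 by rewrite mulr_ge0// ltW// Gamma_gt0//; lra.
apply: ler_pM => //.
by rewrite ler_pM//; lra.
Qed.

(** By [fact_Gamma_le], the Bessel series is dominated by that of cosh. This growth, which is
    slower than that of any Gaussian, makes integrable all the products below, including the odd
    ones. *)
Lemma normr_bessel_j_le mu x : - (1 / 2) <= mu -> `|bessel_j mu x| <= expR `|x|.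
Proof.
move=> hmu; rewrite bessel_jE.
have G0 : 0 < Gamma (mu + 1) by apply: Gamma_gt0; lra.
have cb := @bessel_term_cvg R mu x hmu.
have cb' : (Gamma (mu + 1) * series (bessel_term mu x) n) @[n --> \oo] -->
    Gamma (mu + 1) * limn (series (bessel_term mu x)) by apply: cvgMr.
have cn : `|Gamma (mu + 1) * series (bessel_term mu x) n| @[n --> \oo] -->
    `|Gamma (mu + 1) * limn (series (bessel_term mu x))| by apply: cvg_norm.
rewrite -(cvg_lim _ cn)//.
apply: limr_le; first by apply/cvg_ex; eexists; exact: cn.
apply: nearW => n; rewrite normrM gtr0_norm//.
apply: (@le_trans _ _ (\sum_(0 <= i < n) exp_coeff `|x| (2 * i)%N)).
  rewrite /series /=; apply: le_trans (ler_wpM2l (ltW G0) (ler_norm_sum _ _ _)) _.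
  rewrite mulr_sumr; apply: ler_sum => i _.
  have Gi := Gamma_nat_gt0 i hmu.
  rewrite /bessel_term !normrM normrX normrN1 expr1n mul1r normrX.
  rewrite (normrM x) !normfV (normrM i`!%:R) (gtr0_norm Gi) !normr_nat.
  rewrite /exp_coeff /= exprMn exprVn (exprM 2) expr2 -natrM.
  have := fact_Gamma_le i hmu.
  set g := Gamma (_ + _ + 1) in Gi *; set g1 := Gamma (mu + 1) in G0 *.
  have := fact_gt0 i; have := fact_gt0 (2 * i); rewrite -!(ltr0n R).
  set F := (2 * i)`!%:R; set f := i`!%:R; set q := (2 * 2)%:R ^+ i => F0 f0 H.
  have q0 : 0 < q by rewrite exprn_gt0.
  rewrite [leLHS](_ : _ = `|x| ^+ (2 * i) * (g1 / (q * f * g))); last first.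
    by field; rewrite !gt_eqF.
  rewrite ler_wpM2l ?exprn_ge0// ler_pdivrMr ?mulr_gt0// mulrC -ler_pdivrMr ?invr_gt0// invrK mulrC.
  by apply: le_trans H _; rewrite /q natrM -expr2 -natrX.
apply: (@le_trans _ _ (series (exp_coeff `|x|) (2 * n)%N)).
  elim: n => [|n IH]; first by rewrite /series /= !big_geq.
  rewrite mulnS big_nat_recr//= /series /= addSn addSn add0n !big_nat_recr//= -addrA.
  by apply: lerD IH _; rewrite lerDl exp_coeff_ge0.
rewrite /expR; apply: nondecreasing_cvgn_le; last exact: is_cvg_series_exp_coeff.
apply/nondecreasing_seqP => k; rewrite /series /= big_nat_recr//= lerDl.
exact: exp_coeff_ge0.
Qed.

Lemma measurable_bessel_j mu : - (1 / 2) <= mu -> measurable_fun setT (bessel_j mu : R -> R).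
Proof.
move=> hmu.
have : measurable_fun setT (fun x : R => limn (series (bessel_term mu x))).
  apply: (measurable_fun_cvg (h := fun n x => series (bessel_term mu x) n)) => //; last first.
    by move=> x _; exact: bessel_term_cvg.
  move=> n; apply: measurable_sum => i; rewrite /bessel_term.
  apply: measurable_funM => //; apply: measurable_funM => //.
  by apply: measurable_funX; apply: measurable_funM.
by move=> H; apply: measurable_funM.
Qed.

(** Half of the Gaussian absorbs the exponential, by completing the square. *)
Lemma gauss_dominated_L1 mu t (g : R -> R) A B : - (1 / 2) <= mu -> 0 < t ->
  measurable_fun setT g -> (forall v, `|g v| <= A * expR (B * `|v|)) ->
  L1 (fun v => g v * (expR (- (t * v ^+ 2)) * weight mu v)).
Proof.
move=> hmu t0 mg hg.
have t20 : 0 < t / 2 by lra.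
have := L1Z (A * expR (B ^+ 2 / (2 * t))) (gauss_weight_L1 hmu t20).
apply: le_integrable => //.
  apply/measurable_EFinP; apply: measurable_funM => //; apply: measurable_funM.
    exact: continuous_measurable_fun (@continuous_expRN_sqr R t).
  exact: measurable_weight.
move=> v _; rewrite /= lee_fin.
have A0 : 0 <= A.
  by have := le_trans (normr_ge0 _) (hg 0); rewrite pmulr_lge0// expR_gt0.
rewrite normrM; set ew := expR _ * weight _ _.
have ew0 : 0 <= ew by rewrite mulr_ge0 ?expR_ge0 ?weight_ge0.
rewrite (ger0_norm ew0) [leRHS]ger0_norm ?mulr_ge0 ?expR_ge0 ?weight_ge0//.
apply: (@le_trans _ _ (A * expR (B * `|v|) * ew)).
  by rewrite ler_wpM2r.
rewrite /ew [leLHS]mulrA [leRHS]mulrA ler_wpM2r ?weight_ge0//.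
rewrite -[leLHS]mulrA -[leRHS]mulrA ler_wpM2l// -!expRD ler_expR.
rewrite -subr_ge0 -(real_normK (num_real v)).
have -> : B ^+ 2 / (2 * t) - t / 2 * `|v| ^+ 2 - (B * `|v| - t * `|v| ^+ 2) =
  (B - t * `|v|) ^+ 2 / (2 * t) by field; rewrite gt_eqF.
by rewrite divr_ge0 ?sqr_ge0//; lra.
Qed.

Definition gsum n c (s : nat -> R) v := \sum_(i < n) c i * expR (- (s i * v ^+ 2)).

Lemma gsumN n c s v : gsum n c s (- v) = gsum n c s v.
Proof. by rewrite /gsum sqrrN. Qed.

Lemma measurable_gsum n c s : measurable_fun setT (gsum n c s).
Proof.
apply: measurable_sum => i; apply: measurable_funM => //.
exact: continuous_measurable_fun (@continuous_expRN_sqr R (s i)).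
Qed.

Lemma mul_gsum n c s (g : R -> R) mu v :
  g v * gsum n c s v * weight mu v =
  \sum_(i < n) c i * (g v * (expR (- (s i * v ^+ 2)) * weight mu v)).
Proof. by rewrite /gsum mulr_sumr mulr_suml; apply: eq_bigr => i _; ring. Qed.

Lemma gsum_L1 mu n c s (g : R -> R) A B : - (1 / 2) <= mu -> (forall i, 0 < s i) ->
  measurable_fun setT g -> (forall v, `|g v| <= A * expR (B * `|v|)) ->
  L1 (fun v => g v * gsum n c s v * weight mu v).
Proof.
move=> hmu s0 mg hg; apply: eq_L1 (fun v => esym (mul_gsum _ _ _ _ _ _)) _.
by apply: L1_sum => i; apply: L1Z; exact: gauss_dominated_L1 hg.
Qed.

Lemma Rint_gsum mu n c s (g : R -> R) A B : - (1 / 2) <= mu -> (forall i, 0 < s i) ->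
  measurable_fun setT g -> (forall v, `|g v| <= A * expR (B * `|v|)) ->
  \int[leb]_v (g v * gsum n c s v * weight mu v) =
  \sum_(i < n) c i * \int[leb]_v (g v * (expR (- (s i * v ^+ 2)) * weight mu v)).
Proof.
move=> hmu s0 mg hg; under eq_Rintegral do rewrite mul_gsum.
have gL i : L1 (fun v => g v * (expR (- (s i * v ^+ 2)) * weight mu v)).
  exact: gauss_dominated_L1 hg.
rewrite Rint_sum; last by move=> i; apply: L1Z.
by apply: eq_bigr => i _; rewrite RintegralZl.
Qed.

Lemma gsum_bounded n c s : (forall i, 0 < s i) -> exists A, forall v, `|gsum n c s v| <= A.
Proof.
move=> s0; exists (\sum_(i < n) `|c i|) => v.
apply: le_trans (ler_norm_sum _ _ _) _; apply: ler_sum => i _.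
rewrite normrM (ger0_norm (expR_ge0 _)) ler_piMr// expR_le1 oppr_le0.
by rewrite mulr_ge0 ?sqr_ge0// ltW.
Qed.

Lemma gsum_sqr_L1 mu n m c s c' s' : - (1 / 2) <= mu -> (forall i, 0 < s i) ->
  (forall i, 0 < s' i) ->
  L1 (fun v => gsum n c s v * gsum m c' s' v * weight mu v).
Proof.
move=> hmu s0 s0'; have [A hA] := gsum_bounded n c s0.
apply: (@gsum_L1 _ _ _ _ _ A 0) => //; first exact: measurable_gsum.
by move=> v; rewrite mul0r expR0 mulr1.
Qed.

Lemma Rint_gsum_sqr mu n c s : - (1 / 2) <= mu -> (forall i, 0 < s i) ->
  \int[leb]_v (gsum n c s v ^+ 2 * weight mu v) =
  \sum_(i < n) \sum_(j < n)
     c i * c j * (Gamma (mu + 1) * (s i + s j) `^ (- (mu + 1))).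
Proof.
move=> hmu s0; have [A hA] := gsum_bounded n c s0.
under eq_Rintegral do rewrite expr2.
rewrite (@Rint_gsum _ _ _ _ _ A 0)//; last 2 first.
- exact: measurable_gsum.
- by move=> v; rewrite mul0r expR0 mulr1.
apply: eq_bigr => i _.
have E v : gsum n c s v * (expR (- (s i * v ^+ 2)) * weight mu v) =
    expR (- (s i * v ^+ 2)) * gsum n c s v * weight mu v by ring.
under eq_Rintegral do rewrite E.
rewrite (@Rint_gsum _ _ _ _ _ 1 0)//; last 2 first.
- exact: continuous_measurable_fun (@continuous_expRN_sqr R (s i)).
- move=> v; rewrite mul0r expR0 mulr1 ger0_norm ?expR_ge0// expR_le1 oppr_le0.
  by rewrite mulr_ge0 ?sqr_ge0// ltW.
rewrite mulr_sumr; apply: eq_bigr => j _.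
rewrite -mulrA; congr (_ * (_ * _)).
rewrite -Rint_gauss_weight//; last by rewrite addr_gt0.
by apply: eq_Rintegral => v _; rewrite mulrA -expRD; congr (expR _ * _); ring.
Qed.

(** The double product is odd, and [v ^ 2] is absorbed by the weight, which shifts [mu] by one.
    The sign [k] is the one that appears in the transform. *)
Lemma Rint_even_odd_sqr mu n c s m c' s' k : - (1 / 2) <= mu ->
  (forall i, 0 < s i) -> (forall i, 0 < s' i) -> k ^+ 2 = 1 ->
  L1 (fun v => (gsum n c s v + k * (v * gsum m c' s' v)) ^+ 2 * weight mu v) /\
  \int[leb]_v ((gsum n c s v + k * (v * gsum m c' s' v)) ^+ 2 * weight mu v) =
  \int[leb]_v (gsum n c s v ^+ 2 * weight mu v) +
  \int[leb]_v (gsum m c' s' v ^+ 2 * weight (mu + 1) v).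
Proof.
move=> hmu s0 s0' k2.
set A := gsum n c s; set B := gsum m c' s'.
have E v : (A v + k * (v * B v)) ^+ 2 * weight mu v =
   A v ^+ 2 * weight mu v + B v ^+ 2 * weight (mu + 1) v +
   2 * k * (v * A v * B v * weight mu v).
  rewrite -sqr_weight// sqrrD exprMn k2 exprMn; ring.
have LA : L1 (fun v => A v ^+ 2 * weight mu v).
  by apply: eq_L1 (gsum_sqr_L1 n n c c hmu s0 s0) => v; rewrite expr2.
have LB : L1 (fun v => B v ^+ 2 * weight (mu + 1) v).
  have hmu1 : - (1 / 2) <= mu + 1 by lra.
  by apply: eq_L1 (gsum_sqr_L1 m m c' c' hmu1 s0' s0') => v; rewrite expr2.
have LAB : L1 (fun v => 2 * k * (v * A v * B v * weight mu v)).
  apply: L1Z; have [a ha] := gsum_bounded n c s0.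
  apply: (@gsum_L1 _ _ _ _ _ a 1) => //.
    by apply: measurable_funM => //; exact: measurable_gsum.
  move=> v; rewrite normrM mul1r mulrC ler_pM//.
  by apply: le_trans (expR_ge1Dx _); rewrite lerDr.
have LAB2 := L1D (L1D LA LB) LAB.
split; first by apply: eq_L1 LAB2 => v; rewrite E.
under eq_Rintegral do rewrite E.
rewrite RintegralD//; last exact: L1D.
rewrite RintegralD// [X in _ + X]Rint_odd ?addr0//.
  apply: measurable_funM => //; apply: measurable_funM; last exact: measurable_weight.
  apply: measurable_funM; last exact: measurable_gsum.
  by apply: measurable_funM => //; exact: measurable_gsum.
by move=> v; rewrite /A /B !gsumN weightN; ring.
Qed.

End gauss_sums.

(** * Squared moduli and integrals of complex functions *)
Section complex_aux.
Context {R : realType}.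
Implicit Types (z k : R[i]).
Local Notation leb := (@lebesgue_measure R).
Local Notation L1 f := (leb.-integrable setT (EFin \o f)).
Local Notation Re := complex.Re.
Local Notation Im := complex.Im.

(** The norm of [R[i]] takes its values in [R[i]]; this is its square, as a real number. *)
Definition sqn z : R := Re z ^+ 2 + Im z ^+ 2.

Lemma sqn_ge0 z : 0 <= sqn z.
Proof. by rewrite addr_ge0 ?sqr_ge0. Qed.

Lemma sqnM z k : sqn (z * k) = sqn z * sqn k.
Proof. by case: z k => [a b] [c d]; rewrite /sqn /=; ring. Qed.

Lemma sqn_real (x : R) : sqn x%:C = x ^+ 2.
Proof. by rewrite /sqn /= expr0n addr0. Qed.

Lemma sqnV z : sqn z^-1 = (sqn z)^-1.
Proof.
have [->|z0] := eqVneq z 0; first by rewrite invr0 /sqn /= expr0n addr0 invr0.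
have := sqn_real 1; rewrite expr1n -[1%:C](mulfV z0) sqnM => h.
have s0 : sqn z != 0 by apply: contra_eq_neq h => ->; rewrite mul0r eq_sym oner_eq0.
by rewrite -[RHS]mulr1 -h mulKf.
Qed.

Lemma Re_norm_sqn z : Re `|z| `^ 2 = sqn z.
Proof. by rewrite normc_def /= powR_mulrn ?sqrtr_ge0// sqr_sqrtr// sqn_ge0. Qed.

Lemma sqn_expi (x : R) : sqn (expi x) = 1.
Proof. by rewrite /sqn /= cos2Dsin2. Qed.

Lemma expiD (x y : R) : expi (x + y) = expi x * expi y.
Proof. by rewrite /expi cosD sinD /=; congr Complex; ring. Qed.

Lemma cintegralZ k (F : R -> R[i]) : L1 (fun v => Re (F v)) -> L1 (fun v => Im (F v)) ->
  cintegral (fun v => k * F v) = k * cintegral F.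
Proof.
move=> LR LI; case: k => kr ki; rewrite /cintegral.
rewrite [RHS]/(_ * _) /=; congr Complex.
  rewrite -!RintegralZl// -RintegralB//; try exact: L1Z.
  by apply: eq_Rintegral => v _; case: (F v).
rewrite -!RintegralZl// -RintegralD//; try exact: L1Z.
by apply: eq_Rintegral => v _; case: (F v).
Qed.

End complex_aux.

(** * The Dunkl transform of sums of Gaussians *)
Section dunkl_span.
Context {R : realType}.
Implicit Types (a b c d e mu t v w y : R) (p q : {poly R}).
Local Notation leb := (@lebesgue_measure R).
Local Notation L1 f := (leb.-integrable setT (EFin \o f)).
Local Notation Re := complex.Re.
Local Notation Im := complex.Im.

#[local] Opaque Gamma bessel_j weight.

(** The exponents start at [i + 1], because constants are not square integrable; see [gpolyE]. *)
Definition gpoly p : R -> R := gsum (size p) (fun i => p`_i) (fun i => i.+1%:R).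

(** The normalised transform of [gpoly p], taken at the frequency [w / b]. *)
Definition hpoly mu b p : R -> R :=
  gsum (size p) (fun i => p`_i * (2 * `|b| * i.+1%:R) `^ (- (mu + 1)))
    (fun i => (4 * i.+1%:R * b ^+ 2)^-1).

Let ts0 (i : nat) : 0 < i.+1%:R :> R. Proof. by []. Qed.

Let hs0 b (b0 : b != 0) (i : nat) : 0 < (4 * i.+1%:R * b ^+ 2)^-1 :> R.
Proof. by rewrite invr_gt0 mulr_gt0 ?exprn_even_gt0// mulr_gt0. Qed.

(** The Gaussians of ranks n and m have the inner product
    [Gamma (mu + 1) * (n + m) ^ (- (mu + 1))], and so have their transforms. *)
Lemma gpoly_parseval mu b p : - (1 / 2) <= mu -> b != 0 ->
  \int[leb]_v (gpoly p v ^+ 2 * weight mu v) =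
  \int[leb]_w (hpoly mu b p w ^+ 2 * weight mu w).
Proof.
move=> hmu b0; rewrite !Rint_gsum_sqr//; last exact: hs0.
apply: eq_bigr => i _; apply: eq_bigr => j _.
set m := - (mu + 1); set x := i.+1%:R; set z := j.+1%:R.
have x0 : 0 < x by exact: ts0. have z0 : 0 < z by exact: ts0.
have nb0 : 0 < `|b| by rewrite normr_gt0.
rewrite [RHS](_ : _ = p`_i * p`_j * (Gamma (mu + 1) *
  ((2 * `|b| * x) `^ m * (2 * `|b| * z) `^ m *
   ((4 * x * b ^+ 2)^-1 + (4 * z * b ^+ 2)^-1) `^ m))); last by ring.
congr (_ * (_ * _)).
have h i' : 0 <= (4 * i' * b ^+ 2)^-1 = (0 <= i').
  by rewrite invr_ge0 pmulr_lge0 ?exprn_even_gt0// pmulr_rge0.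
have nn u : 0 < u -> 0 <= 2 * `|b| * u by move=> u0; rewrite !mulr_ge0// ltW.
rewrite -!powRM ?addr_ge0 ?h ?mulr_ge0 ?nn ?ltW//.
congr (_ `^ m).
have -> : b ^+ 2 = `|b| ^+ 2 by rewrite real_normK ?num_real.
by field; rewrite !gt_eqF.
Qed.

Lemma bessel_growth mu y v : - (1 / 2) <= mu ->
  `|bessel_j mu (y * v)| <= 1 * expR (`|y| * `|v|).
Proof.
by move=> hmu; rewrite mul1r (le_trans (normr_bessel_j_le _ _))// normrM.
Qed.

Let mbessel mu y : - (1 / 2) <= mu -> measurable_fun setT (fun v => bessel_j mu (y * v)).
Proof.
move=> hmu; apply: (@measurableT_comp _ _ _ _ _ _ (bessel_j mu)).
  exact: measurable_bessel_j.
exact: measurable_funM.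
Qed.

Lemma growth_mulv (g : R -> R) A B v : (forall v, `|g v| <= A * expR (B * `|v|)) ->
  `|v * g v| <= A * expR ((B + 1) * `|v|).
Proof.
move=> hg; rewrite normrM mulrDl mul1r expRD mulrC mulrA ler_pM//.
by apply: le_trans (expR_ge1Dx _); rewrite lerDr.
Qed.

Lemma hankel_gpoly mu y p : - (1 / 2) <= mu ->
  \int[leb]_v (bessel_j mu (y * v) * gpoly p v * weight mu v) =
  Gamma (mu + 1) * \sum_(i < size p) p`_i * (i.+1%:R `^ (- (mu + 1)) *
    expR (- (y ^+ 2 / (4 * i.+1%:R)))).
Proof.
move=> hmu; rewrite (@Rint_gsum _ _ _ _ _ _ 1 `|y|)//; last 2 first.
- exact: mbessel.
- by move=> v; exact: bessel_growth.
rewrite mulr_sumr; apply: eq_bigr => i _.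
by rewrite (hankel_gauss _ hmu (ts0 i)).2; ring.
Qed.

Let K mu y v := y * v / (2 * (mu + 1)) * bessel_j (mu + 1) (y * v).

(** The kernel and the function give one factor [v] each, which turns the weight of [mu] into that
    of [mu + 1]; the recurrence of Gamma adjusts the constant. *)
Lemma dunkl_gpoly_odd mu y q : - (1 / 2) <= mu ->
  \int[leb]_v (K mu y v * (v * gpoly q v) * weight mu v) =
  y / 2 * (Gamma (mu + 1) * \sum_(i < size q) q`_i * (i.+1%:R `^ (- (mu + 2)) *
    expR (- (y ^+ 2 / (4 * i.+1%:R))))).
Proof.
move=> hmu; have hmu1 : - (1 / 2) <= mu + 1 by lra.
have mu0 : mu + 1 != 0 by apply/eqP; lra.
have -> : \int[leb]_v (K mu y v * (v * gpoly q v) * weight mu v) =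
  \int[leb]_v (y / (2 * (mu + 1)) * (bessel_j (mu + 1) (y * v) * gpoly q v * weight (mu + 1) v)).
  by apply: eq_Rintegral => v _; rewrite -sqr_weight// /K; ring.
rewrite RintegralZl//; last first.
  apply: (@gsum_L1 _ _ _ _ _ _ 1 `|y|) => //; first exact: mbessel.
  by move=> v; exact: bessel_growth.
rewrite hankel_gpoly//.
have hx : 2^-1 <= mu + 1 by lra.
rewrite (GammaS hx) (_ : mu + 1 + 1 = mu + 2); last by ring.
by field.
Qed.

Lemma dunkl_gpoly_L1 mu y p : - (1 / 2) <= mu ->
  [/\ L1 (fun v => bessel_j mu (y * v) * gpoly p v * weight mu v),
      L1 (fun v => bessel_j mu (y * v) * (v * gpoly p v) * weight mu v),
      L1 (fun v => K mu y v * gpoly p v * weight mu v) &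
      L1 (fun v => K mu y v * (v * gpoly p v) * weight mu v)].
Proof.
move=> hmu; have hmu1 : - (1 / 2) <= mu + 1 by lra.
have gK v : `|K mu y v| <= `|y / (2 * (mu + 1))| * expR ((`|y| + 1) * `|v|).
  rewrite /K (_ : _ * _ = y / (2 * (mu + 1)) * (v * bessel_j (mu + 1) (y * v))); last by ring.
  rewrite normrM ler_wpM2l//.
  have := @growth_mulv (fun u => bessel_j (mu + 1) (y * u)) 1 `|y| v.
  by rewrite mul1r; apply => u; exact: bessel_growth.
have mK : measurable_fun setT (K mu y).
  apply: measurable_funM; last exact: mbessel.
  by apply: measurable_funM => //; apply: measurable_funM.
split.
- apply: (@gsum_L1 _ _ _ _ _ _ 1 `|y|) => //; first exact: mbessel.
  by move=> v; exact: bessel_growth.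
- apply: (@eq_L1 _ (fun v => v * bessel_j mu (y * v) * gpoly p v * weight mu v)).
    by move=> v; ring.
  have mJ : measurable_fun setT (fun v => v * bessel_j mu (y * v)).
    apply: measurable_funM; [exact: measurable_id|exact: mbessel].
  apply: (gsum_L1 _ _ hmu ts0 mJ) => v.
  by apply: (@growth_mulv (fun u => bessel_j mu (y * u))) => u; exact: bessel_growth.
- exact: (gsum_L1 _ _ hmu ts0 mK gK).
- apply: (@eq_L1 _ (fun v => v * K mu y v * gpoly p v * weight mu v)).
    by move=> v; ring.
  have mvK : measurable_fun setT (fun v => v * K mu y v).
    apply: measurable_funM; [exact: measurable_id|exact: mK].
  apply: (gsum_L1 _ _ hmu ts0 mvK) => v.
  by apply: growth_mulv => u; exact: gK.
Qed.

Definition gspan p1 q1 p2 q2 v : R[i] :=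
  (gpoly p1 v + v * gpoly q1 v) +i* (gpoly p2 v + v * gpoly q2 v).

(** Only the products of two functions of the same parity contribute. *)
Lemma cintegral_dunkl_gspan mu y p1 q1 p2 q2 : - (1 / 2) <= mu ->
  let F v := dunkl_kernel mu y v * gspan p1 q1 p2 q2 v * (weight mu v)%:C in
  [/\ L1 (fun v => Re (F v)), L1 (fun v => Im (F v)) &
   cintegral F =
  (\int[leb]_v (bessel_j mu (y * v) * gpoly p1 v * weight mu v) -
   \int[leb]_v (K mu y v * (v * gpoly q2 v) * weight mu v)) +i*
  (\int[leb]_v (bessel_j mu (y * v) * gpoly p2 v * weight mu v) +
   \int[leb]_v (K mu y v * (v * gpoly q1 v) * weight mu v))].
Proof.
move=> hmu F; have hmu1 : - (1 / 2) <= mu + 1 by lra.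
have [A1 _ C1 _] := dunkl_gpoly_L1 y p1 hmu.
have [_ B2 _ D2] := dunkl_gpoly_L1 y q1 hmu.
have [A3 _ C3 _] := dunkl_gpoly_L1 y p2 hmu.
have [_ B4 _ D4] := dunkl_gpoly_L1 y q2 hmu.
have RE v : Re (F v) = (bessel_j mu (y * v) * gpoly p1 v * weight mu v -
    K mu y v * (v * gpoly q2 v) * weight mu v) +
   (bessel_j mu (y * v) * (v * gpoly q1 v) * weight mu v -
    K mu y v * gpoly p2 v * weight mu v).
  rewrite /F /dunkl_kernel /gspan -/(K mu y v).
  move: (bessel_j mu (y * v)) (K mu y v) (gpoly p1 v) (gpoly q1 v) (gpoly p2 v) (gpoly q2 v)
    (weight mu v).
  by move=> j k g1 h1 g2 h2 x /=; ring.
have IE v : Im (F v) = (bessel_j mu (y * v) * gpoly p2 v * weight mu v +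
    K mu y v * (v * gpoly q1 v) * weight mu v) +
   (bessel_j mu (y * v) * (v * gpoly q2 v) * weight mu v +
    K mu y v * gpoly p1 v * weight mu v).
  rewrite /F /dunkl_kernel /gspan -/(K mu y v).
  move: (bessel_j mu (y * v)) (K mu y v) (gpoly p1 v) (gpoly q1 v) (gpoly p2 v) (gpoly q2 v)
    (weight mu v).
  by move=> j k g1 h1 g2 h2 x /=; ring.
have KN v : K mu y (- v) = - K mu y v.
  by rewrite /K !mulrN bessel_jN; ring.
have gN p v : gpoly p (- v) = gpoly p v by exact: gsumN.
have JN v : bessel_j mu (y * - v) = bessel_j mu (y * v).
  by rewrite mulrN bessel_jN.
have LR1 := L1B A1 D4; have LR2 := L1B B2 C3.
have LI1 := L1D A3 D2; have LI2 := L1D B4 C1.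
split.
- by apply: eq_L1 (L1D LR1 LR2) => v; rewrite RE.
- by apply: eq_L1 (L1D LI1 LI2) => v; rewrite IE.
rewrite /cintegral; congr Complex.
  under eq_Rintegral do rewrite RE.
  rewrite RintegralD// RintegralB// [X in _ + X]Rint_odd ?addr0//.
    by apply/measurable_EFinP; exact: measurable_int LR2.
  by move=> v; rewrite weightN JN KN !gN; ring.
under eq_Rintegral do rewrite IE.
rewrite RintegralD// RintegralD// [X in _ + X]Rint_odd ?addr0//.
  by apply/measurable_EFinP; exact: measurable_int LI2.
by move=> v; rewrite weightN JN KN !gN; ring.
Qed.

Lemma sqn_cpow_i b s : b != 0 -> sqn (cpow (0 +i* b) s) = (`|b| `^ s) ^+ 2.
Proof.
move=> b0; rewrite /cpow sqnM sqn_expi mulr1 sqn_real normc_def /=.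
by rewrite expr0n add0r sqrtr_sqr.
Qed.

(** The chirps have modulus 1 and disappear. The frequency is [y = - w / b], and the sign [k]
    comes from [y * `|b| = k * w]. *)
Lemma sqn_qpd_gspan a b c d e mu p1 q1 p2 q2 w : b != 0 -> - (1 / 2) <= mu ->
  let k := - (`|b| / b) in
  sqn (qpd_integral a b c d e mu
    (fun v => expi (a * v ^+ 2 + d * v) * gspan p1 q1 p2 q2 v) w) =
  (hpoly mu b p1 w + (- k) * (w * hpoly (mu + 1) b q2 w)) ^+ 2 +
  (hpoly mu b p2 w + k * (w * hpoly (mu + 1) b q1 w)) ^+ 2.
Proof.
move=> b0 hmu k; rewrite /qpd_integral.
pose F v := dunkl_kernel mu (- w / b) v * gspan p1 q1 p2 q2 v * (weight mu v)%:C.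
have [LR LI IE] := @cintegral_dunkl_gspan mu (- w / b) p1 q1 p2 q2 hmu.
have -> : cintegral (fun v => qpd_kernel a b c d e mu w v *
    (expi (a * v ^+ 2 + d * v) * gspan p1 q1 p2 q2 v) * (weight mu v)%:C) =
    expi (- (c * w ^+ 2 + e * w)) * cintegral F.
  rewrite -cintegralZ//; congr cintegral; apply/funext => v.
  rewrite /qpd_kernel /F.
  have -> : - (c * w ^+ 2 + e * w) =
    - (a * v ^+ 2 + c * w ^+ 2 + d * v + e * w) + (a * v ^+ 2 + d * v) by ring.
  rewrite [in RHS]expiD.
  move: (expi (- _)) (expi (a * _ + _)) (dunkl_kernel _ _ _) (gspan _ _ _ _ _) (_%:C).
  by move=> x1 x2 x3 x4 x5; ring.
rewrite !sqnM sqn_expi mul1r sqn_real sqnV sqn_cpow_i// IE.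
rewrite !hankel_gpoly// !dunkl_gpoly_odd// /sqn /=.
set X := \sum_(_ < _) _; set Y := \sum_(_ < _) _.
set Z := \sum_(_ < _) _; set W := \sum_(_ < _) _.
have nb0 : 0 < `|b| by rewrite normr_gt0.
have G0 : 0 < Gamma (mu + 1) by apply: Gamma_gt0; lra.
have E p : hpoly mu b p w = 2 `^ (- (mu + 1)) * `|b| `^ (- (mu + 1)) *
    \sum_(i < size p) p`_i * (i.+1%:R `^ (- (mu + 1)) *
      expR (- ((- w / b) ^+ 2 / (4 * i.+1%:R)))).
  rewrite /hpoly /gsum mulr_sumr; apply: eq_bigr => i _.
  rewrite !powRM ?mulr_ge0//.
  have -> : (4 * i.+1%:R * b ^+ 2)^-1 * w ^+ 2 = (- w / b) ^+ 2 / (4 * i.+1%:R).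
    by field; rewrite b0 nat1r pnatr_eq0.
  by ring.
have E' q : hpoly (mu + 1) b q w = 2 `^ (- (mu + 1)) / 2 * (`|b| `^ (- (mu + 1)) / `|b|) *
    \sum_(i < size q) q`_i * (i.+1%:R `^ (- (mu + 2)) *
      expR (- ((- w / b) ^+ 2 / (4 * i.+1%:R)))).
  rewrite /hpoly /gsum mulr_sumr; apply: eq_bigr => i _.
  rewrite !powRM ?mulr_ge0//.
  have -> : (4 * i.+1%:R * b ^+ 2)^-1 * w ^+ 2 = (- w / b) ^+ 2 / (4 * i.+1%:R).
    by field; rewrite b0 nat1r pnatr_eq0.
  have -> : - (mu + 1 + 1) = - (mu + 2) by ring.
  have D x : 0 < x -> x `^ (- (mu + 2)) = x `^ (- (mu + 1)) / x.
    move=> x0; rewrite -[in RHS](powR_inv1 (ltW x0)) -powRD; last by rewrite (gt_eqF x0) implybT.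
    by congr (_ `^ _); ring.
  by rewrite (D 2)// (D `|b|)//; ring.
rewrite !E !E' -/X -/Y -/Z -/W.
rewrite /c_ !powRN /k.
have A0 : 0 < 2 `^ (mu + 1) :> R by exact: powR_gt0.
have B0 : 0 < `|b| `^ (mu + 1) by exact: powR_gt0.
move: `|b| X Y Z W (2 `^ _) (`|b| `^ _) (Gamma _) A0 B0 G0 nb0.
move=> n X Y Z W A B G A0 B0 G0 n0.
by field; rewrite b0 !gt_eqF.
Qed.

End dunkl_span.

(** * Chirped Gaussians are Schwartz functions *)
Section chirp_gaussians.
Context {R : realType}.
Variable th : {poly R}.
Implicit Types (P Q : {poly R}) (f g : R -> R) (v : R).

Definition chirp_gauss k P Q v : R :=
  (P.[v] * cos th.[v] + Q.[v] * sin th.[v]) * expR (- (k.+1%:R * v ^+ 2)).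

(** Chosen because it is stable under derivation and under multiplication by monomials: its
    elements are Schwartz functions as soon as they are bounded. *)
Inductive chirp_span : (R -> R) -> Prop :=
| chirp_span_gauss k P Q : chirp_span (chirp_gauss k P Q)
| chirp_spanD f g : chirp_span f -> chirp_span g -> chirp_span (fun v => f v + g v).

Lemma eq_chirp_span f g : f =1 g -> chirp_span f -> chirp_span g.
Proof. by move=> /funext ->. Qed.

Lemma chirp_span_sum n (h : 'I_n -> R -> R) : (forall i, chirp_span (h i)) ->
  chirp_span (fun v => \sum_(i < n) h i v).
Proof.
elim: n h => [|n IH] h hh.
  apply: eq_chirp_span (chirp_span_gauss 0 0 0) => v.
  by rewrite big_ord0 /chirp_gauss !horner0 !mul0r addr0 mul0r.
apply: eq_chirp_span (chirp_spanD (hh ord0) (IH (fun i => h (lift ord0 i)) _)) => v.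
  by rewrite big_ord_recl.
by [].
Qed.

Lemma is_derive_chirp_gauss k P Q v :
  is_derive v 1 (chirp_gauss k P Q)
    (chirp_gauss k (P^`() + Q * th^`() - (2 * k.+1%:R) *: ('X * P))
                   (Q^`() - P * th^`() - (2 * k.+1%:R) *: ('X * Q)) v).
Proof.
have dh P' : is_derive v 1 (horner P') P'^`().[v].
  by split; [exact: derivable_horner|rewrite -derive1E derivE].
have dc : is_derive v 1 (cos \o horner th) (- sin th.[v] * th^`().[v]).
  by apply: is_derive1_comp.
have ds : is_derive v 1 (sin \o horner th) (cos th.[v] * th^`().[v]).
  by apply: is_derive1_comp.
have de : is_derive v 1 (expR \o horner (- (k.+1%:R *: 'X^2)))
    (expR (- (k.+1%:R * v ^+ 2)) * (- (2 * k.+1%:R * v))).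
  have := is_derive1_comp (is_derive_expR _) (dh (- (k.+1%:R *: 'X^2))).
  move=> H; apply: is_derive_eq H _.
  by rewrite derivN derivZ derivXn !hornerE; congr (_ * _); ring.
have := is_deriveM (is_deriveD (is_deriveM (dh P) dc) (is_deriveM (dh Q) ds)) de.
rewrite (_ : (horner P * _ + _) * _ = chirp_gauss k P Q); last first.
  by apply/funext => u; rewrite /chirp_gauss !fctE /= !hornerE.
move=> H; apply: is_derive_eq H _.
rewrite /chirp_gauss !fctE /= !hornerE /GRing.scale /=.
by move: (expR _) (cos _) (sin _) => e c s; ring.
Qed.

Lemma derivable_chirp_span f : chirp_span f ->
  (forall v, derivable f v 1) /\ chirp_span f^`()%classic.
Proof.
elim=> [k P Q|{}f g _ [df sf] _ [dg sg]].
  split; first by move=> v; case: (is_derive_chirp_gauss k P Q v).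
  apply: eq_chirp_span (chirp_span_gauss k (P^`() + Q * th^`() - (2 * k.+1%:R) *: ('X * P))
                   (Q^`() - P * th^`() - (2 * k.+1%:R) *: ('X * Q))) => v.
  by rewrite derive1E; case: (is_derive_chirp_gauss k P Q v).
split; first by move=> v; apply: derivableD.
apply: eq_chirp_span (chirp_spanD sf sg) => v.
by rewrite !derive1E deriveD.
Qed.

Lemma chirp_spanXn m f : chirp_span f -> chirp_span (fun v => v ^+ m * f v).
Proof.
elim=> [k P Q|{}f g _ sf _ sg].
  apply: eq_chirp_span (chirp_span_gauss k ('X^m * P) ('X^m * Q)) => v.
  by rewrite /chirp_gauss !(hornerM, hornerXn); ring.
by apply: eq_chirp_span (chirp_spanD sf sg) => v; rewrite mulrDr.
Qed.

Lemma poly_gauss_bounded P : exists M, forall v, `|P.[v]| * expR (- v ^+ 2) <= M.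
Proof.
exists (\sum_(i < size P) `|P`_i| * (i`!%:R * expR 1)) => v.
rewrite horner_coef; apply: le_trans (ler_wpM2r (expR_ge0 _) (ler_norm_sum _ _ _)) _.
rewrite mulr_suml; apply: ler_sum => i _.
rewrite normrM normrX -mulrA ler_wpM2l//.
have h : `|v| ^+ i <= i`!%:R * expR `|v|.
  case: (nat_of_ord i) => [|n]; first by rewrite expr0 fact0 mul1r -expR0 ler_expR.
  rewrite mulrC -ler_pdivrMr ?ltr0n ?fact_gt0//.
  have := @expR_ge1Dxn R `|v| n (normr_ge0 v) => h.
  by apply: le_trans h; rewrite lerDr.
apply: le_trans (ler_wpM2r (expR_ge0 _) h) _.
rewrite -mulrA ler_wpM2l// -expRD ler_expR -(real_normK (num_real v)).
have := sqr_ge0 (`|v| - 1); have := normr_ge0 v; nra.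
Qed.

Lemma chirp_span_bounded f : chirp_span f -> exists M, forall v, `|f v| <= M.
Proof.
elim=> [k P Q|{}f g _ [M hM] _ [N hN]]; last first.
  by exists (M + N) => v; apply: le_trans (ler_normD _ _) _; apply: lerD.
have [M hM] := poly_gauss_bounded P; have [N hN] := poly_gauss_bounded Q.
exists (M + N) => v; rewrite /chirp_gauss normrM (ger0_norm (expR_ge0 _)).
apply: (@le_trans _ _ ((`|P.[v]| + `|Q.[v]|) * expR (- v ^+ 2))).
  rewrite ler_pM ?expR_ge0//.
    apply: le_trans (ler_normD _ _) _; rewrite !normrM lerD// ler_piMr// ler_norml.
      by rewrite cos_geN1 cos_le1.
    by rewrite sin_geN1 sin_le1.
  by rewrite ler_expR lerN2 ler_peMl ?sqr_ge0// ler1n.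
by rewrite mulrDl lerD.
Qed.

Lemma chirp_span_schwartz f : chirp_span f -> real_schwartz f.
Proof.
move=> sf; have sfn n : chirp_span (derive1n n f).
  by elim: n => // n IH; have [] := derivable_chirp_span IH.
split=> [n v|m n]; first by have [] := derivable_chirp_span (sfn n).
exact: chirp_span_bounded (chirp_spanXn m (sfn n)).
Qed.

End chirp_gaussians.

Lemma schwartz_chirp_gspan {R : realType} (a d : R) p1 q1 p2 q2 :
  schwartz (fun v => expi (a * v ^+ 2 + d * v) * gspan p1 q1 p2 q2 v).
Proof.
have [th thE] : exists th : {poly R}, forall v, th.[v] = a * v ^+ 2 + d * v.
  by exists (a *: 'X^2 + d *: 'X) => v; rewrite !hornerE.
have sum4 (h1 h2 h3 h4 : R -> R) : chirp_span th h1 -> chirp_span th h2 -> chirp_span th h3 ->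
    chirp_span th h4 -> chirp_span th (fun v => (h1 v + h2 v) + (h3 v + h4 v)).
  by move=> s1 s2 s3 s4; apply: chirp_spanD; apply: chirp_spanD.
have S p (u u' : {poly R}) :
    chirp_span th (fun v => (u.[v] * cos th.[v] + u'.[v] * sin th.[v]) * gpoly p v).
  apply: eq_chirp_span (@chirp_span_sum R th (size p)
    (fun i => chirp_gauss th i (p`_i *: u) (p`_i *: u')) _) => [v|i]; last exact: chirp_span_gauss.
  rewrite /gpoly /gsum mulr_sumr; apply: eq_bigr => i _.
  by rewrite /chirp_gauss !hornerZ; ring.
split; apply: (@chirp_span_schwartz R th).
  apply: eq_chirp_span (sum4 _ _ _ _ (S p1 1%:P 0%:P) (S q1 'X 0%:P)
    (S p2 0%:P (-1)%:P) (S q2 0%:P (- 'X))) => v.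
  by rewrite /expi /gspan /= -thE !(hornerN, hornerX, hornerC); ring.
apply: eq_chirp_span (sum4 _ _ _ _ (S p1 0%:P 1%:P) (S q1 0%:P 'X)
  (S p2 1%:P 0%:P) (S q2 'X 0%:P)) => v.
by rewrite /expi /gspan /= -thE !(hornerN, hornerX, hornerC); ring.
Qed.

(** * Polynomial approximation of continuous functions *)
Section weierstrass.
Context {R : realType}.
Implicit Types (g h : nat -> R) (x a : R).

(** The Bernstein polynomial, as the expectation of [g] at a binomial variable of parameters [n]
    and ['X]. Conditioning on the first trial gives a recursion without binomial
    coefficients. *)
Fixpoint bernstein n g : {poly R} :=
  if n is n'.+1 then
    'X * bernstein n' (g \o succn) + (1%:P - 'X) * bernstein n' g
  else (g 0%N)%:P.

Lemma bernsteinSE n g x : (bernstein n.+1 g).[x] =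
  x * (bernstein n (g \o succn)).[x] + (1 - x) * (bernstein n g).[x].
Proof. by rewrite /= !(hornerD, hornerN, hornerM, hornerX, hornerC). Qed.

Lemma le_bernstein n g h x : 0 <= x <= 1 ->
  (forall k, (k <= n)%N -> g k <= h k) -> (bernstein n g).[x] <= (bernstein n h).[x].
Proof.
move=> /andP[x0 x1]; elim: n g h => [|n IH] g h gh.
  by rewrite /= !hornerC gh.
rewrite !bernsteinSE lerD// ler_wpM2l ?subr_ge0//.
  by apply: IH => k kn /=; apply: gh.
by apply: IH => k kn; apply: gh; exact: leqW.
Qed.

Lemma bernstein_lin n (c : R) g h x :
  (bernstein n (fun k => c * g k + h k)).[x] = c * (bernstein n g).[x] + (bernstein n h).[x].
Proof.
elim: n g h => [|n IH] g h; first by rewrite /= !hornerC.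
rewrite !bernsteinSE IH (_ : _ \o succn = fun k => c * (g \o succn) k + (h \o succn) k)//.
by rewrite IH; ring.
Qed.

Lemma bernstein_cst n (c : R) x : (bernstein n (fun=> c)).[x] = c.
Proof.
elim: n => [|n IH]; first by rewrite /= hornerC.
by rewrite bernsteinSE (_ : _ \o succn = fun=> c)// IH; ring.
Qed.

Lemma bernstein_variance n a x :
  (bernstein n (fun k => (k%:R - a) ^+ 2)).[x] = n%:R * x * (1 - x) + (n%:R * x - a) ^+ 2.
Proof.
elim: n a => [|n IH] a; first by rewrite /= hornerC; ring.
rewrite bernsteinSE IH.
rewrite (_ : _ \o succn = fun k => (k%:R - (a - 1)) ^+ 2); last first.
  by apply/funext => k /=; rewrite -natr1; congr (_ ^+ 2); ring.
by rewrite IH -natr1; ring.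
Qed.

Lemma segment_unif_continuous (psi : R -> R) (e : R) : continuous psi -> 0 < e ->
  exists2 d : R, 0 < d & forall x y, 0 <= x <= 1 -> `|x - y| < d -> `|psi x - psi y| < e.
Proof.
move=> cpsi e0.
have /compact_near_coveringP/(_ _ (0^'+)
    (fun d x => forall y, `|x - y| < d -> `|psi x - psi y| < e)) :=
  @segment_compact R 0 1.
case.
  move=> x _; have e20 : 0 < e / 2 by rewrite divr_gt0.
  have /cvgrPdist_lt/(_ _ e20)/nbhs_ballP[r /= r0 hr] := cpsi x.
  have r20 : 0 < r / 2 by rewrite divr_gt0.
  exists (ball x (r / 2), [set d | d < r / 2]) => /=.
    split; first exact: nbhsx_ballx.
    exact: nbhs_right_lt.
  move=> [z d] /= [xz dr] y zy.
  have hz : `|psi x - psi z| < e / 2.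
    by apply: hr; apply: lt_le_trans xz _; lra.
  have hy : `|psi x - psi y| < e / 2.
    apply: hr; rewrite /ball /= -(subrKA z).
    apply: le_lt_trans (ler_normD _ _) _.
    by rewrite (splitr r) ltrD// (lt_trans zy).
  rewrite -(subrKA (psi x)); apply: le_lt_trans (ler_normD _ _) _.
  by rewrite (splitr e) ltrD// distrC.
move=> r /= r0 hr; have r20 : 0 < r / 2 by rewrite divr_gt0.
exists (r / 2) => // x y x01 xy; apply: (hr (r / 2)) => //=.
by rewrite sub0r normrN gtr0_norm// ltr_pdivrMr// ltr_pMr// ltr1n.
Qed.

(** Bernstein's proof. The error [psi x - psi (k / n)] is at most [e / 2] when [k / n] is close
    to [x], and a multiple of [(k / n - x) ^ 2] otherwise, the mean of which is at most
    [1 / n]. *)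
Theorem weierstrass_approximation (psi : R -> R) (e : R) : continuous psi -> 0 < e ->
  exists p : {poly R}, forall x, 0 <= x <= 1 -> `|psi x - p.[x]| <= e.
Proof.
move=> cpsi e0; have e20 : 0 < e / 2 by rewrite divr_gt0.
have [d d0 hd] := segment_unif_continuous cpsi e20.
have [M M0 hM] : exists2 M, 0 <= M & forall x, 0 <= x <= 1 -> `|psi x| <= M.
  have [|c _ hc] := @EVT_max R (fun x => `|psi x|) 0 1 ler01.
    by apply: continuous_subspaceT => x; apply: cvg_norm; exact: cpsi.
  by exists `|psi c| => // x x01; apply: hc; rewrite in_itv.
pose C := 2 * M / d ^+ 2.
have C0 : 0 <= C by apply: divr_ge0; [exact: mulr_ge0|exact: sqr_ge0].
pose n := (Num.truncn (C / (e / 2))).+1.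
have n0 : 0 < n%:R :> R by [].
exists (bernstein n (fun k => psi (k%:R / n%:R))) => x x01.
have {x01} [x0 x1] := andP x01; have x01 : 0 <= x <= 1 by rewrite x0 x1.
pose r k := C / n%:R ^+ 2 * (k%:R - n%:R * x) ^+ 2 + e / 2.
have rE : (bernstein n r).[x] <= e.
  rewrite /r bernstein_lin bernstein_variance bernstein_cst subrr expr0n addr0 /=.
  rewrite {2}(splitr e) lerD2r.
  rewrite [leLHS](_ : _ = C / n%:R * (x * (1 - x))); last by field; rewrite gt_eqF.
  apply: (@le_trans _ _ (C / n%:R)).
    rewrite ler_piMr ?divr_ge0 ?(ltW n0)//; nra.
  by rewrite ler_pdivrMr// mulrC -ler_pdivrMr// ltW// truncnS_gt.
have key k : (k <= n)%N -> `|psi x - psi (k%:R / n%:R)| <= r k.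
  move=> kn; have kn01 : 0 <= (k%:R / n%:R : R) <= 1.
    by rewrite divr_ge0 ?(ltW n0)//= ler_pdivrMr// mul1r ler_nat.
  have [h|h] := ltP `|x - k%:R / n%:R| d.
    by rewrite /r (le_trans (ltW (hd _ _ x01 h)))// lerDr mulr_ge0 ?sqr_ge0// divr_ge0// sqr_ge0.
  apply: (@le_trans _ _ (2 * M)).
    apply: le_trans (ler_normB _ _) _.
    by have := hM _ x01; have := hM _ kn01; lra.
  rewrite /r -[leLHS]addr0 lerD ?(ltW e20)//.
  have -> : C / n%:R ^+ 2 * (k%:R - n%:R * x) ^+ 2 = 2 * M * (`|x - k%:R / n%:R| ^+ 2 / d ^+ 2).
    rewrite real_normK ?num_real// /C; field.
    by rewrite !gt_eqF.
  rewrite ler_peMr ?mulr_ge0// ler_pdivlMr ?exprn_gt0// mul1r.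
  by rewrite ler_pXn2r ?nnegrE ?(ltW d0).
have up : (bernstein n (fun k => -1 * psi (k%:R / n%:R) + psi x)).[x] <= e.
  apply: le_trans rE; apply: le_bernstein => // k kn.
  by have := key k kn; rewrite ler_norml => /andP[_]; lra.
have dn : - e <= (bernstein n (fun k => -1 * psi (k%:R / n%:R) + psi x)).[x].
  rewrite lerNl; apply: le_trans rE.
  have -> : - (bernstein n (fun k => -1 * psi (k%:R / n%:R) + psi x)).[x] =
    (bernstein n (fun k => -1 * (-1 * psi (k%:R / n%:R) + psi x) + 0)).[x].
    by rewrite !bernstein_lin !bernstein_cst; ring.
  apply: le_bernstein => // k kn.
  by have := key k kn; rewrite ler_norml => /andP[+ _]; lra.
rewrite bernstein_lin bernstein_cst in up dn.
by rewrite ler_norml; apply/andP; split; lra.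
Qed.

End weierstrass.

(** * Uniform approximation by sums of Gaussians *)
Section uniform_gauss.
Context {R : realType}.
Implicit Types (v N : R) (phi G : R -> R) (p q : {poly R}).

Lemma gpolyE p v : gpoly p v = expR (- v ^+ 2) * p.[expR (- v ^+ 2)].
Proof.
rewrite /gpoly /gsum horner_coef mulr_sumr; apply: eq_bigr => i _.
rewrite [in RHS]mulrCA -exprS -expRM_natl; congr (_ * expR _); ring.
Qed.

(** As [phi] is even and vanishes at infinity, [phi v * expR (v ^ 2)] is a continuous function
    [psi] of [x = expR (- v ^ 2)] on [[0, 1]], which polynomials approximate; see [gpolyE]. *)
Lemma even_gpoly_approx phi N e : continuous phi -> (forall v, phi (- v) = phi v) ->
  0 <= N -> (forall v, N <= `|v| -> phi v = 0) -> 0 < e ->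
  exists p, forall v, `|phi v - gpoly p v| <= e * expR (- v ^+ 2).
Proof.
move=> cphi ephi N0 phi0 e0.
pose psi x := if 0 < x then phi (Num.sqrt (- ln x)) / x else 0.
have psi0 x : x < expR (- N ^+ 2) -> psi x = 0.
  rewrite /psi => xN; case: ifPn => // x0; rewrite phi0 ?mul0r//.
  rewrite ger0_norm ?sqrtr_ge0// -(ger0_norm N0) -sqrtr_sqr ler_sqrt ?sqr_ge0//.
    by rewrite lerNr -[leRHS]expRK ler_ln ?posrE ?expR_gt0// ltW.
  rewrite lerNr oppr0 ln_le0// (le_trans (ltW xN))// expR_le1 oppr_le0 sqr_ge0//.
have cpsi : continuous psi.
  move=> x; have [x0|x0] := ltP 0 x; last first.
    rewrite /continuous_at psi0; last by rewrite (le_lt_trans x0)// expR_gt0.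
    apply: cvg_near_cst; near=> y; apply: psi0.
    near: y; apply: lt_nbhsl; by rewrite (le_lt_trans x0)// expR_gt0.
  have cg : {for x, continuous (fun y => phi (Num.sqrt (- ln y)) / y)}.
    apply: cvgM; last by apply: cvgV; [rewrite gt_eqF|exact: cvg_id].
    apply: (@continuous_comp _ _ _ (fun y : R => Num.sqrt (- ln y)) phi); last exact: cphi.
    apply: (@continuous_comp _ _ _ (fun y : R => - ln y) Num.sqrt); last exact: sqrt_continuous.
    by apply: cvgN; exact: continuous_ln.
  rewrite /continuous_at [psi x]/psi x0.
  apply: cvg_trans cg; apply: near_eq_cvg; near=> y.
  by rewrite /psi ifT//; near: y; exact: lt_nbhsr.
have [p hp] := weierstrass_approximation cpsi e0.
exists p => v; set x := expR (- v ^+ 2).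
have x0 : 0 < x by exact: expR_gt0.
have x1 : x <= 1 by rewrite expR_le1 oppr_le0 sqr_ge0.
have -> : phi v = x * psi x.
  rewrite /psi x0 mulrCA divff ?gt_eqF// mulr1 /x expRK opprK sqrtr_sqr.
  have [v0|v0] := leP 0 v; first by rewrite ger0_norm.
  by rewrite ltr0_norm// ephi.
rewrite gpolyE -/x -mulrBr normrM (gtr0_norm x0) mulrC ler_wpM2r ?(ltW x0)//.
by apply: hp; rewrite (ltW x0).
Unshelve. all: by end_near. Qed.

(** [G] is the sum of an even function and of [v] times an even function; the latter is continuous
    because [G] vanishes near 0. *)
Lemma gpoly_approx G N eta e : continuous G -> 0 <= N -> 0 < eta ->
  (forall v, N <= `|v| -> G v = 0) -> (forall v, `|v| <= eta -> G v = 0) -> 0 < e ->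
  exists p q, forall v,
    `|G v - (gpoly p v + v * gpoly q v)| <= e * ((1 + `|v|) * expR (- v ^+ 2)).
Proof.
move=> cG N0 eta0 GN Geta e0.
have cGN : continuous (fun v => G (- v)).
  by move=> v; apply: (@continuous_comp _ _ _ -%R G); [exact: opp_continuous|exact: cG].
pose Ge v := (G v + G (- v)) / 2; pose Go v := (G v - G (- v)) / 2 / v.
have cGe : continuous Ge.
  by move=> v; apply: cvgM; [apply: cvgD; [exact: cG|exact: cGN]|exact: cvg_cst].
have Go0 v : `|v| <= eta -> Go v = 0.
  by move=> h; rewrite /Go !Geta ?normrN// subrr !mul0r.
have cGo : continuous Go.
  move=> v; have [->|v0] := eqVneq v 0.
    rewrite /continuous_at Go0 ?normr0 ?(ltW eta0)//.
    apply: cvg_near_cst; near=> y; apply: Go0.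
    near: y; apply/nbhs_ballP; exists eta => //= z.
    by rewrite /ball /= sub0r normrN => /ltW.
  apply: cvgM; last by apply: cvgV => //; exact: cvg_id.
  by apply: cvgM; [apply: cvgB; [exact: cG|exact: cGN]|exact: cvg_cst].
have eGe v : Ge (- v) = Ge v by rewrite /Ge opprK addrC.
have eGo v : Go (- v) = Go v by rewrite /Go opprK invrN mulrN -mulNr -mulNr opprB.
have GeN v : N <= `|v| -> Ge v = 0.
  by move=> h; rewrite /Ge !GN ?normrN// addr0 mul0r.
have GoN v : N <= `|v| -> Go v = 0.
  by move=> h; rewrite /Go !GN ?normrN// subrr !mul0r.
have [p hp] := even_gpoly_approx cGe eGe N0 GeN e0.
have [q hq] := even_gpoly_approx cGo eGo N0 GoN e0.
exists p, q => v.
have -> : G v = Ge v + v * Go v.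
  have [->|v0] := eqVneq v 0; first by rewrite mul0r addr0 /Ge oppr0; field.
  by rewrite /Ge /Go; field.
have -> : Ge v + v * Go v - (gpoly p v + v * gpoly q v) =
  (Ge v - gpoly p v) + v * (Go v - gpoly q v) by ring.
apply: le_trans (ler_normD _ _) _.
rewrite [leRHS](_ : _ = e * expR (- v ^+ 2) + `|v| * (e * expR (- v ^+ 2))); last by ring.
by rewrite lerD// normrM ler_wpM2l.
Unshelve. all: by end_near. Qed.

End uniform_gauss.

(** * Density of sums of Gaussians in the weighted L2 space *)
Section weighted_L2.
Context {R : realType}.
Implicit Types (mu v K N eta : R) (f g F G : R -> R) (p q : {poly R}).
Local Notation leb := (@lebesgue_measure R).
Local Notation L1 f := (leb.-integrable setT (EFin \o f)).

Definition wnorm2 mu f := (\int[leb]_v (f v ^+ 2 * weight mu v)%:E)%E.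

Lemma measurable_sqr_weight mu f : measurable_fun setT f ->
  measurable_fun setT (fun v => (f v ^+ 2 * weight mu v)%:E).
Proof.
move=> mf; apply/measurable_EFinP; apply: measurable_funM; last exact: measurable_weight.
exact: measurable_funX.
Qed.

Lemma sqr_weight_ge0 mu f v : (0 <= (f v ^+ 2 * weight mu v)%:E)%E.
Proof. by rewrite lee_fin mulr_ge0 ?sqr_ge0 ?weight_ge0. Qed.

Lemma wnorm2D mu f g : measurable_fun setT f -> measurable_fun setT g ->
  (wnorm2 mu (fun v => (f v + g v)%R) <= 2%:E * wnorm2 mu f + 2%:E * wnorm2 mu g)%E.
Proof.
move=> mf mg.
have mf2 := measurable_sqr_weight mu mf; have mg2 := measurable_sqr_weight mu mg.
rewrite -!ge0_integralZl//; last 2 first.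
- by move=> v _; exact: sqr_weight_ge0.
- by move=> v _; exact: sqr_weight_ge0.
rewrite -ge0_integralD//; last 4 first.
- by move=> v _; rewrite mule_ge0 ?sqr_weight_ge0.
- exact: measurable_funeM.
- by move=> v _; rewrite mule_ge0 ?sqr_weight_ge0.
- exact: measurable_funeM.
apply: ge0_le_integral => //.
- by move=> v _; exact: (@sqr_weight_ge0 _ (fun v => f v + g v)).
- by apply: (@measurable_sqr_weight _ (fun v => f v + g v)); exact: measurable_funD.
- by apply: emeasurable_funD; exact: measurable_funeM.
- move=> v _; rewrite -!EFinM -EFinD lee_fin !mulrA -mulrDl.
  rewrite ler_wpM2r ?weight_ge0// -subr_ge0.
  by rewrite (_ : _ - _ = (f v - g v) ^+ 2) ?sqr_ge0//; ring.
Qed.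

Lemma cvge0_exists (u : nat -> \bar R) (e : R) : u @ \oo --> 0%E -> 0 < e ->
  exists n, (u n < e%:E)%E.
Proof.
move=> u0 e0; have [n _ hn] : \forall n \near \oo, (u n < e%:E)%E.
  have H : \forall r \near (0 : R), r < e by exact: lt_nbhsl.
  exact: (u0 [set y | (y < e%:E)%E] H).
by exists n; apply: hn => /=.
Qed.

(** The projection onto [[- K, K]]. *)
Definition clamp K (y : R) := (`|y + K| - `|y - K|) / 2.

Lemma clamp_bound K y : 0 <= K -> `|clamp K y| <= K.
Proof.
by move=> K0; rewrite /clamp; case: (ger0P (y + K)); case: (ger0P (y - K)) => h1 h2;
  rewrite ler_norml; apply/andP; split; lra.
Qed.

Lemma clamp_contract K y z : `|z| <= K -> `|z - clamp K y| <= `|z - y|.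
Proof.
rewrite ler_norml => /andP[h3 h4].
by rewrite /clamp; case: (ger0P (y + K)); case: (ger0P (y - K)); case: (ger0P (z - y)) => h0 h1 h2;
  rewrite ler_norml; apply/andP; split; lra.
Qed.

(** Equal to 0 before 0, to 1 after 1, and affine in between. *)
Definition ramp (y : R) := (`|y| - `|y - 1| + 1) / 2.

Lemma rampP y : [/\ 0 <= ramp y <= 1, y <= 0 -> ramp y = 0 & 1 <= y -> ramp y = 1].
Proof.
by rewrite /ramp; case: (ger0P y); case: (ger0P (y - 1)) => h1 h2; split;
  rewrite ?andbT; try (apply/andP; split); try move=> h3; lra.
Qed.

Lemma continuous_clamp K (u : R -> R) : continuous u -> continuous (fun v => clamp K (u v)).
Proof.
move=> cu v; apply: cvgM; last exact: cvg_cst.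
apply: cvgB; apply: cvg_norm.
  by apply: cvgD; [exact: cu|exact: cvg_cst].
by apply: cvgB; [exact: cu|exact: cvg_cst].
Qed.

Lemma continuous_ramp (u : R -> R) : continuous u -> continuous (fun v => ramp (u v)).
Proof.
move=> cu v; apply: cvgM; last exact: cvg_cst.
apply: cvgD; last exact: cvg_cst.
apply: cvgB; apply: cvg_norm; first exact: cu.
by apply: cvgB; [exact: cu|exact: cvg_cst].
Qed.

(** Continuous functions are dense in L1 of a compact interval; clamping and cutting off
    the approximant bounds the squared error by the L1 error. *)
Lemma bounded_approx mu F K N eta e : - (1 / 2) <= mu -> measurable_fun setT F ->
  0 <= K -> 0 <= N -> 0 < eta -> (forall v, `|F v| <= K) ->
  (forall v, F v != 0 -> eta <= `|v| <= N) -> 0 < e ->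
  exists G, [/\ continuous G, forall v, N + 1 <= `|v| -> G v = 0,
    forall v, `|v| <= eta / 2 -> G v = 0 &
    (wnorm2 mu (fun v => (F v - G v)%R) <= e%:E)%E].
Proof.
move=> hmu mF K0 N0 eta0 FK Fs e0.
pose E := `[- (N + 1), N + 1]%classic : set R.
have mE : measurable E by exact: measurable_itv.
have EP v : E v = (`|v| <= N + 1) :> Prop by rewrite /E /= in_itv /= -ler_norml.
have muE : (leb E < +oo)%E.
  by rewrite lebesgue_measure_itv /=; case: ifP => _; rewrite ltry.
have iF : leb.-integrable E (EFin \o F).
  apply: measurable_bounded_integrable => //; first exact: measurable_funTS.
  exists K; split; first exact: num_real.
  by move=> M KM v _ /=; apply: le_trans (FK v) (ltW KM).
have [g [cg ig gF]] := approximation_continuous_integrable mE muE iF.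
pose W := (N + 1) `^ (2 * mu + 1).
have W0 : 0 <= W by exact: powR_ge0.
pose C := 2 * K * W + 1.
have C0 : 0 < C by rewrite ltr_wpDl// !mulr_ge0.
have [n hn] := cvge0_exists gF (divr_gt0 e0 C0).
(* [chi] is 1 on the support of [F], and vanishes near 0 and infinity *)
pose chi v := ramp (2 * `|v| / eta - 1) * ramp (N + 1 - `|v|).
pose G v := chi v * clamp K (g n v).
have cabs : continuous (fun v : R => `|v|) by exact: norm_continuous.
have cG : continuous G.
  move=> v; apply: cvgM; last exact: (continuous_clamp (cg n)).
  apply: cvgM.
    apply: (@continuous_ramp (fun v => 2 * `|v| / eta - 1)) => u.
    apply: cvgB; last exact: cvg_cst.
    by apply: cvgM; [apply: cvgM; [exact: cvg_cst|exact: cabs]|exact: cvg_cst].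
  apply: (@continuous_ramp (fun v => N + 1 - `|v|)) => u.
  by apply: cvgB; [exact: cvg_cst|exact: cabs].
have GN v : N + 1 <= `|v| -> G v = 0.
  by move=> h; rewrite /G /chi; have [_ hr _] := rampP (N + 1 - `|v|);
    rewrite hr ?mulr0 ?mul0r// subr_le0.
have Geta v : `|v| <= eta / 2 -> G v = 0.
  move=> h; rewrite /G /chi; have [_ hr _] := rampP (2 * `|v| / eta - 1); rewrite hr ?mul0r//.
  by rewrite subr_le0 ler_pdivrMr//; lra.
exists G; split => //.
have pt v : (F v - G v) ^+ 2 <= 2 * K * `|F v - g n v|.
  have [Fv0|Fv0] := eqVneq (F v) 0.
    rewrite Fv0 !sub0r sqrrN normrN /G exprMn.
    have c0 := @clamp_contract K (g n v) 0; rewrite normr0 !sub0r !normrN in c0.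
    have {}c0 := c0 K0.
    have c1 := clamp_bound (g n v) K0.
    have [/andP[r0 r1] _ _] := rampP (2 * `|v| / eta - 1).
    have [/andP[s0 s1] _ _] := rampP (N + 1 - `|v|).
    have chi01 : chi v ^+ 2 <= 1.
      have chi0 : 0 <= chi v by exact: mulr_ge0.
      have chi1 : chi v <= 1 by exact: mulr_ile1.
      by rewrite expr_le1.
    apply: (@le_trans _ _ (clamp K (g n v) ^+ 2)); first by rewrite ler_piMl ?sqr_ge0.
    rewrite -real_normK ?num_real// expr2; apply: ler_pM => //.
    by apply: le_trans c1 _; lra.
  have /andP[h1 h2] := Fs v Fv0.
  have -> : G v = clamp K (g n v).
    have [_ _ hr1] := rampP (2 * `|v| / eta - 1).
    have [_ _ hr2] := rampP (N + 1 - `|v|).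
    rewrite /G /chi hr1; first by rewrite hr2 ?mul1r//; lra.
    by rewrite lerBrDr ler_pdivlMr//; lra.
  rewrite -real_normK ?num_real// expr2; apply: ler_pM => //.
    apply: le_trans (ler_normB _ _) _.
    by have := FK v; have := clamp_bound (g n v) K0; lra.
  exact: clamp_contract.
have out v : ~ E v -> F v - G v = 0.
  rewrite EP => /negP; rewrite -ltNge => h; rewrite GN ?(ltW h)// subr0.
  by apply/eqP; apply: contraTT h => /Fs /andP[_ h]; rewrite -leNgt; lra.
have mFG : measurable_fun setT (fun v => F v - G v).
  by apply: measurable_funB => //; exact: continuous_measurable_fun.
have -> : wnorm2 mu (fun v => F v - G v) =
    (\int[leb]_(v in E) ((F v - G v) ^+ 2 * weight mu v)%:E)%E.
  rewrite [RHS]integral_mkcond; apply: eq_integral => v _.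
  rewrite patchE; case: ifPn => // /negP; rewrite inE => /out ->.
  by rewrite expr0n mul0r.
have mg : measurable_fun E (fun v => `|(F v - g n v)%:E|%E).
  apply: measurableT_comp => //; apply/measurable_EFinP; apply: measurable_funTS.
  by apply: measurable_funB => //; exact: continuous_measurable_fun.
apply: (@le_trans _ _ (\int[leb]_(v in E) (C%:E * `|(F v - g n v)%:E|))%E).
  apply: ge0_le_integral => //.
  - by move=> v _; exact: (@sqr_weight_ge0 _ (fun v => F v - G v)).
  - apply: measurable_funTS; exact: (@measurable_sqr_weight _ (fun v => F v - G v)).
  - exact: measurable_funeM.
  - move=> v; rewrite EP => vE; rewrite /= lee_fin.
    apply: (@le_trans _ _ (2 * K * `|F v - g n v| * W)); last first.
      by rewrite [leLHS]mulrAC /C ler_wpM2r// lerDl.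
    apply: ler_pM; rewrite ?sqr_ge0 ?weight_ge0//.
    rewrite /weight /W ge0_ler_powR ?nnegrE//; lra.
rewrite ge0_integralZl//; last by rewrite lee_fin ltW.
have : (C%:E * \int[leb]_(v in E) `|(F v - g n v)%:E| <= C%:E * (e / C)%:E)%E.
  by apply: lee_wpmul2l; [rewrite lee_fin ltW|exact: ltW].
by rewrite -EFinM mulrCA divff ?gt_eqF// mulr1.
Qed.

(** Dominated convergence. Values near 0 are cut off too, which prepares [gpoly_approx]. *)
Lemma truncation_approx mu f e : - (1 / 2) <= mu -> measurable_fun setT f ->
  (wnorm2 mu f < +oo)%E -> 0 < e ->
  exists n : nat, exists F, [/\ measurable_fun setT F, forall v, `|F v| <= n.+1%:R,
    forall v, F v != 0 -> n.+1%:R^-1 <= `|v| <= n.+1%:R &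
    (wnorm2 mu (fun v => (f v - F v)%R) <= e%:E)%E].
Proof.
move=> hmu mf f2 e0.
pose A n := [set v : R | [&& `|f v| <= n.+1%:R, n.+1%:R^-1 <= `|v| & `|v| <= n.+1%:R]].
pose F n v := f v * \1_(A n) v.
have mabs : measurable_fun setT (fun v : R => `|v|) by exact: normr_measurable.
have mA n : measurable (A n).
  rewrite (_ : A n = (fun v => `|f v|) @^-1` `]-oo, n.+1%:R] `&`
    ((fun v => `|v|) @^-1` `[n.+1%:R^-1, n.+1%:R])); last first.
    apply/seteqP; split => v /=; rewrite !in_itv /=.
      by move=> /and3P[-> -> ->].
    by move=> [h1 /andP[h2 h3]]; apply/and3P.
  apply: measurableI; rewrite -[X in measurable X]setTI.
    have mfn : measurable_fun setT (fun v => `|f v|) by exact: measurableT_comp.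
    exact: mfn.
  exact: mabs.
have mF n : measurable_fun setT (F n).
  apply: measurable_funM => //; exact: measurable_indic.
have dom n v : (f v - F n v) ^+ 2 * weight mu v <= f v ^+ 2 * weight mu v.
  rewrite ler_wpM2r ?weight_ge0// /F indicE.
  by case: (_ \in _); rewrite ?mulr1 ?subrr ?expr0n ?sqr_ge0// mulr0 subr0.
have [|||_ _ H] := @dominated_convergence _ _ _ leb _ measurableT
  (fun n v => ((f v - F n v) ^+ 2 * weight mu v)%:E) (cst 0%E)
  (fun v => (f v ^+ 2 * weight mu v)%:E)
  (fun n => @measurable_sqr_weight mu (fun v => f v - F n v) (measurable_funB mf (mF n)))
  (measurable_cst _) _ _ _.
- exists [set 0]; split => //; first exact: lebesgue_measure_set1.
  move=> v /= H; apply: contrapT => /eqP v0; apply: H => _.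
  have av0 : 0 < `|v| by rewrite normr_gt0.
  apply: cvg_near_cst; near=> n.
  suff vA : v \in A n by rewrite /F indicE vA mulr1 subrr expr0n mul0r.
  rewrite inE /A /=; apply/and3P; split.
  - near: n; exists (Num.truncn `|f v|) => // m /= hm.
    by rewrite (le_trans (ltW (truncnS_gt _)))// ler_nat.
  - near: n; exists (Num.truncn `|v|^-1) => // m /= hm.
    rewrite invf_ple ?posrE//.
    by rewrite (le_trans (ltW (truncnS_gt _)))// ler_nat.
  - near: n; exists (Num.truncn `|v|) => // m /= hm.
    by rewrite (le_trans (ltW (truncnS_gt _)))// ler_nat.
- apply/integrableP; split; first exact: measurable_sqr_weight.
  by under eq_integral do rewrite gee0_abs ?sqr_weight_ge0//.
- apply: aeW => v n _; rewrite gee0_abs ?lee_fin//.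
  by rewrite mulr_ge0 ?sqr_ge0 ?weight_ge0.
rewrite integral0 in H.
have [n hn] := cvge0_exists H e0.
exists n, (F n); split => //; last exact: ltW.
  move=> v; rewrite /F indicE; case: (boolP (_ \in _)) => [|_]; last by rewrite mulr0 normr0.
  by rewrite inE => /and3P[h _ _]; rewrite mulr1.
move=> v; rewrite /F indicE; case: (boolP (_ \in _)) => [|_]; last by rewrite mulr0 eqxx.
by rewrite inE => /and3P[_ -> ->].
Unshelve. all: by end_near. Qed.

Lemma measurable_gpoly2 p q : measurable_fun setT (fun v : R => gpoly p v + v * gpoly q v).
Proof.
apply: measurable_funD; first exact: measurable_gsum.
by apply: measurable_funM => //; exact: measurable_gsum.
Qed.

Lemma gpoly_approx_L2 mu G N eta e : - (1 / 2) <= mu -> continuous G -> 0 <= N -> 0 < eta ->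
  (forall v, N <= `|v| -> G v = 0) -> (forall v, `|v| <= eta -> G v = 0) -> 0 < e ->
  exists p q, (wnorm2 mu (fun v => (G v - (gpoly p v + v * gpoly q v))%R) <= e%:E)%E.
Proof.
move=> hmu cG N0 eta0 GN Geta e0.
pose h v := (1 + `|v|) * expR (- v ^+ 2).
have mh : measurable_fun setT h.
  apply: measurable_funM; first by apply: measurable_funD => //; exact: normr_measurable.
  by apply: (eq_measurable_fun (fun v => expR (- (1 * v ^+ 2)))) => [v _|]; rewrite ?mul1r//;
    exact: continuous_measurable_fun (@continuous_expRN_sqr R 1).
have hL : L1 (fun v => h v ^+ 2 * weight mu v).
  have m1 : measurable_fun setT (fun v : R => (1 + `|v|) ^+ 2).
    by apply: measurable_funX; apply: measurable_funD => //; exact: normr_measurable.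
  have b1 v : `|(1 + `|v|) ^+ 2| <= 1 * expR (2 * `|v|).
    rewrite mul1r expRM_natl ger0_norm ?sqr_ge0// ler_pXn2r ?nnegrE ?expR_ge0 ?addr_ge0//.
    exact: expR_ge1Dx.
  have t2 : 0 < 2 :> R by [].
  apply: eq_L1 (gauss_dominated_L1 hmu t2 m1 b1) => v.
  by rewrite /h exprMn -expRM_natl mulrN mulrA.
pose C := fine (wnorm2 mu h).
have hC : wnorm2 mu h = C%:E by rewrite /C fineK//; exact: integrable_fin_num hL.
have C0 : 0 <= C by rewrite -lee_fin -hC; apply: integral_ge0 => v _; exact: sqr_weight_ge0.
pose e' := Num.sqrt (e / (C + 1)).
have C1 : 0 < C + 1 by rewrite ltr_wpDl.
have e'0 : 0 < e' by rewrite sqrtr_gt0 divr_gt0.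
have [p [q hpq]] := gpoly_approx cG N0 eta0 GN Geta e'0.
exists p, q.
apply: (@le_trans _ _ ((e' ^+ 2)%:E * wnorm2 mu h)%E).
  rewrite -ge0_integralZl//; last 3 first.
  - exact: measurable_sqr_weight.
  - by move=> v _; exact: sqr_weight_ge0.
  - by rewrite lee_fin sqr_ge0.
  have mGp : measurable_fun setT (fun v => G v - (gpoly p v + v * gpoly q v)).
    apply: measurable_funB; first exact: continuous_measurable_fun.
    exact: measurable_gpoly2.
  apply: ge0_le_integral => //.
  - by move=> v _; exact: (@sqr_weight_ge0 _ (fun v => (G v - (gpoly p v + v * gpoly q v)))).
  - exact: (@measurable_sqr_weight _ (fun v => (G v - (gpoly p v + v * gpoly q v)))).
  - by apply: measurable_funeM; exact: measurable_sqr_weight.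
  - move=> v _; rewrite -EFinM lee_fin mulrA ler_wpM2r ?weight_ge0//.
    rewrite -exprMn -real_normK ?num_real// ler_pXn2r ?nnegrE//.
    by rewrite mulr_ge0 ?(ltW e'0)// mulr_ge0 ?expR_ge0// addr_ge0.
rewrite hC -EFinM lee_fin sqr_sqrtr ?divr_ge0 ?(ltW e0) ?(ltW C1)//.
by rewrite mulrAC ler_pdivrMr// ler_pM2l//; lra.
Qed.

(** Truncation, then continuous approximation, then approximation by Gaussians. *)
Theorem gpoly_dense mu f e : - (1 / 2) <= mu -> measurable_fun setT f ->
  (wnorm2 mu f < +oo)%E -> 0 < e ->
  exists p q, (wnorm2 mu (fun v => (f v - (gpoly p v + v * gpoly q v))%R) <= e%:E)%E.
Proof.
(* the three errors enter with the factors 2, 4 and 4 *)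
move=> hmu mf f2 e0; have e10 : 0 < e / 10 by rewrite divr_gt0.
have [n [F [mF Fn Fs hF]]] := truncation_approx hmu mf f2 e10.
have n0 : 0 < n.+1%:R :> R by [].
have ni0 : 0 < n.+1%:R^-1 :> R by rewrite invr_gt0.
have [G [cG GN Geta hG]] := bounded_approx hmu mF (ltW n0) (ltW n0) ni0 Fn Fs e10.
have N10 : 0 <= n.+1%:R + 1 :> R by rewrite addr_ge0.
have [p [q hpq]] := gpoly_approx_L2 hmu cG N10 (divr_gt0 ni0 (ltr0n _ 2)) GN Geta e10.
exists p, q.
have mG : measurable_fun setT G by exact: continuous_measurable_fun.
have mfF : measurable_fun setT (fun v => f v - F v) by exact: measurable_funB.
have mFG : measurable_fun setT (fun v => F v - G v) by exact: measurable_funB.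
have mGs : measurable_fun setT (fun v => G v - (gpoly p v + v * gpoly q v)).
  by apply: measurable_funB => //; exact: measurable_gpoly2.
have E1 : (fun v => f v - (gpoly p v + v * gpoly q v)) =
  (fun v => (f v - F v) + ((F v - G v) + (G v - (gpoly p v + v * gpoly q v)))).
  by apply/funext => v; ring.
rewrite E1; apply: le_trans (wnorm2D _ mfF (measurable_funD mFG mGs)) _.
apply: (@le_trans _ _ (2%:E * (e / 10)%:E + 2%:E * (2%:E * (e / 10)%:E + 2%:E * (e / 10)%:E))%E).
  apply: leeD; first exact: lee_wpmul2l.
  apply: lee_wpmul2l => //; apply: le_trans (wnorm2D _ mFG mGs) _.
  by apply: leeD; exact: lee_wpmul2l.
suff : 2 * (e / 10) + 2 * (2 * (e / 10) + 2 * (e / 10)) <= e by rewrite -lee_fin.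
lra.
Qed.

End weighted_L2.

(** * The weighted L2 space of complex functions *)
Section complex_L2.
Context {R : realType}.
Implicit Types (mu : R) (f g h : R -> R[i]) (k : R[i]).
Local Notation leb := (@lebesgue_measure R).
Local Notation L1 f := (leb.-integrable setT (EFin \o f)).
Local Notation Re := complex.Re.
Local Notation Im := complex.Im.

Definition cnorm2 mu f := \int[leb]_v (sqn (f v) * weight mu v).

Lemma sqnN k : sqn (- k) = sqn k.
Proof. by case: k => x y; rewrite /sqn /= !sqrrN. Qed.

Lemma Lp_norm2E mu f :
  Lp_norm mu 2 f = ((\int[leb]_v (sqn (f v) * weight mu v)%:E) `^ 2^-1)%E.
Proof.
rewrite /Lp_norm; congr (_ `^ _)%E.
by apply: eq_integral => v _; rewrite Re_norm_sqn.
Qed.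

Lemma measurable_sqn f : measurable_fun setT (fun v => Re (f v)) ->
  measurable_fun setT (fun v => Im (f v)) -> measurable_fun setT (fun v => sqn (f v)).
Proof. by move=> mr mi; apply: measurable_funD; exact: measurable_funX. Qed.

Lemma sqn_weight_ge0 mu f v : 0 <= sqn (f v) * weight mu v.
Proof. by rewrite mulr_ge0 ?sqn_ge0 ?weight_ge0. Qed.

Lemma in_L2P mu f : in_Lp mu 2 f <->
  [/\ measurable_fun setT (fun v => Re (f v)), measurable_fun setT (fun v => Im (f v)) &
      L1 (fun v => sqn (f v) * weight mu v)].
Proof.
have n2 : 2^-1 != 0 :> R by rewrite invr_eq0.
split=> -[mr mi].
  rewrite Lp_norm2E => /(lty_poweRy n2) h; split => //.
  apply/integrableP; split.
    apply/measurable_EFinP; apply: measurable_funM; last exact: measurable_weight.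
    exact: measurable_sqn.
  by under eq_integral do rewrite gee0_abs ?lee_fin ?sqn_weight_ge0//.
move=> h; split => //; rewrite Lp_norm2E; apply: poweR_lty.
exact: integrable_lty h.
Qed.

Lemma cnorm2E mu f : in_Lp mu 2 f ->
  (\int[leb]_v (sqn (f v) * weight mu v)%:E)%E = (cnorm2 mu f)%:E.
Proof.
by move=> /in_L2P[_ _ h]; rewrite /cnorm2 /Rintegral fineK//; exact: integrable_fin_num h.
Qed.

Lemma cnorm2_ge0 mu f : 0 <= cnorm2 mu f.
Proof. by apply: Rintegral_ge0 => v _; exact: sqn_weight_ge0. Qed.

Lemma Lp_norm2_lt mu f (e : R) : in_Lp mu 2 f -> 0 < e ->
  (Lp_norm mu 2 f < e%:E)%E = (cnorm2 mu f < e ^+ 2).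
Proof.
move=> f2 e0; rewrite Lp_norm2E cnorm2E// poweR_EFin lte_fin powR12_sqrt ?cnorm2_ge0//.
by rewrite -[in LHS](ger0_norm (ltW e0)) -sqrtr_sqr ltr_sqrt// exprn_gt0.
Qed.

(** A triangle inequality for squared norms. *)
Lemma sqn_add_le (e : R) z k : 0 < e -> sqn (z + k) <= (1 + e) * sqn z + (1 + e^-1) * sqn k.
Proof.
move=> e0; case: z k => [a b] [c d]; rewrite /sqn /=.
rewrite -subr_ge0 [X in 0 <= X](_ : _ = ((e * a - c) ^+ 2 + (e * b - d) ^+ 2) / e).
  by rewrite divr_ge0 ?(ltW e0)// addr_ge0 ?sqr_ge0.
by field; rewrite gt_eqF.
Qed.

Lemma in_L2_comb mu k f g : in_Lp mu 2 f -> in_Lp mu 2 g ->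
  in_Lp mu 2 (fun v => k * f v + g v).
Proof.
move=> /in_L2P[mfr mfi Lf] /in_L2P[mgr mgi Lg]; apply/in_L2P.
have mr : measurable_fun setT (fun v => Re (k * f v + g v)).
  apply: (eq_measurable_fun (fun v => (Re k * Re (f v) - Im k * Im (f v)) + Re (g v))).
    by move=> v _; move: (k) (f v) (g v) => [a b] [c d] [x y].
  apply: measurable_funD => //; apply: measurable_funB; exact: measurable_funM.
have mi : measurable_fun setT (fun v => Im (k * f v + g v)).
  apply: (eq_measurable_fun (fun v => (Re k * Im (f v) + Im k * Re (f v)) + Im (g v))).
    by move=> v _; move: (k) (f v) (g v) => [a b] [c d] [x y].
  apply: measurable_funD => //; apply: measurable_funD; exact: measurable_funM.
split => //.
apply: le_integrable (L1D (L1Z (2 * sqn k) Lf) (L1Z 2 Lg)) => //.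
  apply/measurable_EFinP; apply: measurable_funM; last exact: measurable_weight.
  exact: (@measurable_sqn (fun v => k * f v + g v)).
move=> v _; rewrite /= lee_fin.
rewrite ger0_norm; last exact: (@sqn_weight_ge0 _ (fun v => k * f v + g v)).
apply: le_trans (ler_norm _).
have := @sqn_add_le 1 (k * f v) (g v) ltr01; rewrite invr1 sqnM => h.
apply: le_trans (ler_wpM2r (weight_ge0 mu v) h) _.
rewrite [leRHS](_ : _ = ((1 + 1) * (sqn k * sqn (f v)) + (1 + 1) * sqn (g v)) * weight mu v)//.
ring.
Qed.

Lemma in_L2B mu f g : in_Lp mu 2 f -> in_Lp mu 2 g -> in_Lp mu 2 (fun v => f v - g v).
Proof.
move=> f2 g2; have := @in_L2_comb mu (-1) g f g2 f2.
by rewrite (_ : (fun v => _) = (fun v => f v - g v))//; apply/funext => v; rewrite mulN1r addrC.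
Qed.

Lemma cnorm2_approx mu f g (e : R) : in_Lp mu 2 f -> in_Lp mu 2 g -> 0 < e ->
  cnorm2 mu f <= (1 + e) * cnorm2 mu g + (1 + e^-1) * cnorm2 mu (fun v => f v - g v).
Proof.
move=> f2 g2 e0.
have /in_L2P[_ _ Lf] := f2; have /in_L2P[_ _ Lg] := g2.
have /in_L2P[_ _ LB] := in_L2B f2 g2.
rewrite /cnorm2 -!RintegralZl// -RintegralD//; [|exact: L1Z|exact: L1Z].
apply: le_Rintegral => //; first by apply: L1D; exact: L1Z.
move=> v _; rewrite !mulrA -mulrDl ler_wpM2r ?weight_ge0//.
by rewrite -{1}(subrKC (g v) (f v)) sqn_add_le.
Qed.

Lemma ae_eq_sqn mu f g : {ae leb, forall w, f w = g w} ->
  ae_eq leb setT (fun w => (sqn (f w) * weight mu w)%:E) (fun w => (sqn (g w) * weight mu w)%:E).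
Proof.
move=> [N [mN N0 sub]]; exists N; split => // w /= H; apply: sub => /= fgw.
by apply: H => _; rewrite fgw.
Qed.

Lemma cnorm2_ae mu f g : in_Lp mu 2 f -> in_Lp mu 2 g ->
  {ae leb, forall w, f w = g w} -> cnorm2 mu f = cnorm2 mu g.
Proof.
move=> /in_L2P[_ _ Lf] /in_L2P[_ _ Lg] fg; rewrite /cnorm2 /Rintegral; congr fine.
apply: ae_eq_integral => //; [exact: measurable_int Lf|exact: measurable_int Lg|].
exact: ae_eq_sqn.
Qed.

(** The factors [k = 1] and [k = - 'i] give the real and the imaginary part of the inner
    product. *)
Definition rinner mu k f g := \int[leb]_v (Re (k * (f v * conjc (g v))) * weight mu v).

Lemma rinner_L1 mu k f g : in_Lp mu 2 f -> in_Lp mu 2 g ->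
  L1 (fun v => Re (k * (f v * conjc (g v))) * weight mu v).
Proof.
move=> f2 g2; have /in_L2P[_ _ Lf] := f2; have /in_L2P[_ _ Lg] := g2.
have /in_L2P[_ _ LD] := in_L2_comb k f2 g2.
apply: eq_L1 (L1Z (2^-1) (L1B LD (L1D (L1Z (sqn k) Lf) Lg))) => v.
by move: (k) (f v) (g v) => [a b] [c d] [x y]; rewrite /sqn /=; field.
Qed.

Lemma cnorm2_polar mu k f g : in_Lp mu 2 f -> in_Lp mu 2 g ->
  cnorm2 mu (fun v => k * f v + g v) =
  sqn k * cnorm2 mu f + cnorm2 mu g + 2 * rinner mu k f g.
Proof.
move=> f2 g2; have /in_L2P[_ _ Lf] := f2; have /in_L2P[_ _ Lg] := g2.
have Lfg := rinner_L1 k f2 g2.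
rewrite /cnorm2 /rinner -!RintegralZl//.
rewrite -RintegralD//; last exact: L1Z.
rewrite -RintegralD//; [|by apply: L1D => //; exact: L1Z|exact: L1Z].
apply: eq_Rintegral => v _.
by move: (k) (f v) (g v) => [a b] [c d] [x y]; rewrite /sqn /=; ring.
Qed.

Lemma cintegral_rinner mu f g :
  cintegral (fun v => f v * conjc (g v) * (weight mu v)%:C) =
  rinner mu 1 f g +i* rinner mu (- 'i) f g.
Proof.
rewrite /cintegral /rinner; congr Complex; apply: eq_Rintegral => v _.
  by case: (f v) (g v) => [c d] [x y] /=; ring.
by case: (f v) (g v) => [c d] [x y] /=; ring.
Qed.

End complex_L2.

(** * Isometry and polarization *)
Section plancherel.
Context {R : realType}.
Variables (a b c d e mu : R).
Hypotheses (b0 : b != 0) (hmu : - (1 / 2) <= mu).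
Local Notation leb := (@lebesgue_measure R).
Local Notation L1 f := (leb.-integrable setT (EFin \o f)).
Local Notation Re := complex.Re.
Local Notation Im := complex.Im.

Definition chirped p1 q1 p2 q2 v : R[i] :=
  expi (a * v ^+ 2 + d * v) * gspan p1 q1 p2 q2 v.

Lemma measurable_chirp (s : R) :
  measurable_fun setT (fun v : R => cos (s * (a * v ^+ 2 + d * v))) /\
  measurable_fun setT (fun v : R => sin (s * (a * v ^+ 2 + d * v))).
Proof.
have cth : continuous (fun v : R => s * (a * v ^+ 2 + d * v)).
  move=> v; apply: cvgM; first exact: cvg_cst.
  apply: cvgD; apply: cvgM; [exact: cvg_cst|exact: exprn_continuous|exact: cvg_cst|exact: cvg_id].
split; apply: continuous_measurable_fun => v.
  by apply: continuous_comp; [exact: cth|exact: continuous_cos].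
by apply: continuous_comp; [exact: cth|exact: continuous_sin].
Qed.

Lemma measurable_expiM (s : R) (f : R -> R[i]) : measurable_fun setT (fun v => Re (f v)) ->
  measurable_fun setT (fun v => Im (f v)) ->
  measurable_fun setT (fun v : R => Re (expi (s * (a * v ^+ 2 + d * v)) * f v)) /\
  measurable_fun setT (fun v : R => Im (expi (s * (a * v ^+ 2 + d * v)) * f v)).
Proof.
move=> mr mi; have [mc ms] := measurable_chirp s; split.
  apply: (eq_measurable_fun (fun v : R => cos (s * (a * v ^+ 2 + d * v)) * Re (f v) -
                                      sin (s * (a * v ^+ 2 + d * v)) * Im (f v))).
    by move=> v _; case: (f v).
  by apply: measurable_funB; exact: measurable_funM.
apply: (eq_measurable_fun (fun v : R => cos (s * (a * v ^+ 2 + d * v)) * Im (f v) +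
                                    sin (s * (a * v ^+ 2 + d * v)) * Re (f v))).
  by move=> v _; case: (f v).
by apply: measurable_funD; exact: measurable_funM.
Qed.

Lemma sqn_chirped p1 q1 p2 q2 v : sqn (chirped p1 q1 p2 q2 v) =
  (gpoly p1 v + 1 * (v * gpoly q1 v)) ^+ 2 + (gpoly p2 v + 1 * (v * gpoly q2 v)) ^+ 2.
Proof. by rewrite /chirped sqnM sqn_expi mul1r /sqn /= !mul1r. Qed.

Let ts0 (i : nat) : 0 < i.+1%:R :> R. Proof. by []. Qed.

Let hs0 (i : nat) : 0 < (4 * i.+1%:R * b ^+ 2)^-1 :> R.
Proof. by rewrite invr_gt0 mulr_gt0 ?exprn_even_gt0// mulr_gt0. Qed.

Let sqr1 : 1 ^+ 2 = 1 :> R. Proof. by rewrite expr1n. Qed.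

Lemma Rint_gpoly_pair p q :
  L1 (fun v => (gpoly p v + 1 * (v * gpoly q v)) ^+ 2 * weight mu v) /\
  \int[leb]_v ((gpoly p v + 1 * (v * gpoly q v)) ^+ 2 * weight mu v) =
  \int[leb]_v (gpoly p v ^+ 2 * weight mu v) +
  \int[leb]_v (gpoly q v ^+ 2 * weight (mu + 1) v).
Proof. exact: Rint_even_odd_sqr hmu ts0 ts0 sqr1. Qed.

Lemma Rint_hpoly_pair p q k : k ^+ 2 = 1 ->
  L1 (fun w => (hpoly mu b p w + k * (w * hpoly (mu + 1) b q w)) ^+ 2 * weight mu w) /\
  \int[leb]_w ((hpoly mu b p w + k * (w * hpoly (mu + 1) b q w)) ^+ 2 * weight mu w) =
  \int[leb]_v (gpoly p v ^+ 2 * weight mu v) +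
  \int[leb]_v (gpoly q v ^+ 2 * weight (mu + 1) v).
Proof.
move=> k2; have hmu1 : - (1 / 2) <= mu + 1 by rewrite (le_trans hmu)// lerDl.
rewrite (gpoly_parseval p hmu b0) (gpoly_parseval q hmu1 b0).
exact: Rint_even_odd_sqr hmu hs0 hs0 k2.
Qed.

Lemma chirped_L2 p1 q1 p2 q2 : in_Lp mu 2 (chirped p1 q1 p2 q2).
Proof.
have [mr mi] := @measurable_expiM 1 (gspan p1 q1 p2 q2) (measurable_gpoly2 p1 q1)
  (measurable_gpoly2 p2 q2).
apply/in_L2P; split.
- by apply: eq_measurable_fun mr => v _; rewrite mul1r.
- by apply: eq_measurable_fun mi => v _; rewrite mul1r.
have [A _] := Rint_gpoly_pair p1 q1; have [B _] := Rint_gpoly_pair p2 q2.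
by apply: eq_L1 (L1D A B) => v; rewrite sqn_chirped mulrDl.
Qed.

Lemma chirped_isometry p1 q1 p2 q2 :
  let T := qpd_integral a b c d e mu (chirped p1 q1 p2 q2) in
  L1 (fun w => sqn (T w) * weight mu w) /\
  cnorm2 mu T = cnorm2 mu (chirped p1 q1 p2 q2).
Proof.
move=> T; pose k := - (`|b| / b).
have k2 : k ^+ 2 = 1 by rewrite sqrrN expr_div_n real_normK ?num_real// divff// sqrf_eq0.
have k2' : (- k) ^+ 2 = 1 by rewrite sqrrN.
have [A EA] := Rint_gpoly_pair p1 q1; have [B EB] := Rint_gpoly_pair p2 q2.
have [A' EA'] := Rint_hpoly_pair p1 q2 k2'; have [B' EB'] := Rint_hpoly_pair p2 q1 k2.
have TE w : sqn (T w) * weight mu w =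
    (hpoly mu b p1 w + (- k) * (w * hpoly (mu + 1) b q2 w)) ^+ 2 * weight mu w +
    (hpoly mu b p2 w + k * (w * hpoly (mu + 1) b q1 w)) ^+ 2 * weight mu w.
  by rewrite -mulrDl -(sqn_qpd_gspan a c d e p1 q1 p2 q2 w b0 hmu).
split; first by apply: eq_L1 (L1D A' B') => w; rewrite TE.
transitivity (
  \int[leb]_w ((hpoly mu b p1 w + (- k) * (w * hpoly (mu + 1) b q2 w)) ^+ 2 * weight mu w) +
  \int[leb]_w ((hpoly mu b p2 w + k * (w * hpoly (mu + 1) b q1 w)) ^+ 2 * weight mu w)).
  by rewrite -(RintegralD measurableT A' B'); apply: eq_Rintegral => w _; exact: TE.
transitivity (\int[leb]_v ((gpoly p1 v + 1 * (v * gpoly q1 v)) ^+ 2 * weight mu v) +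
  \int[leb]_v ((gpoly p2 v + 1 * (v * gpoly q2 v)) ^+ 2 * weight mu v)); last first.
  rewrite -(RintegralD measurableT A B); apply: eq_Rintegral => v _.
  by rewrite sqn_chirped mulrDl.
by rewrite EA EB EA' EB' addrACA [X in _ + X]addrC addrACA.
Qed.

Lemma chirped_dense f (eps : R) : in_Lp mu 2 f -> 0 < eps ->
  exists p1 q1 p2 q2, cnorm2 mu (fun v => chirped p1 q1 p2 q2 v - f v) < eps.
Proof.
move=> f2 eps0; have /in_L2P[mr mi Lf] := f2.
pose g v := expi (-1 * (a * v ^+ 2 + d * v)) * f v.
have [mgr mgi] := measurable_expiM (-1) mr mi.
have gE v : f v = expi (a * v ^+ 2 + d * v) * g v.
  rewrite /g mulrA -expiD mulN1r subrr /expi cos0 sin0.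
  by rewrite (_ : 1 +i* 0 = 1)// mul1r.
have sg v : sqn (g v) = sqn (f v) by rewrite /g sqnM sqn_expi mul1r.
have fin (u : R -> R) : measurable_fun setT u -> (forall v, u v ^+ 2 <= sqn (g v)) ->
    (wnorm2 mu u < +oo)%E.
  move=> mu_ hu; apply: le_lt_trans (integrable_lty measurableT Lf).
  apply: ge0_le_integral => //.
  - by move=> v _; exact: sqr_weight_ge0.
  - exact: measurable_sqr_weight.
  - exact: measurable_int Lf.
  - by move=> v _; rewrite /= lee_fin -sg ler_wpM2r ?weight_ge0.
have e3 : 0 < eps / 3 by rewrite divr_gt0.
have [|p1 [q1 h1]] := gpoly_dense hmu mgr _ e3.
  by apply: fin => // v; rewrite /sqn lerDl sqr_ge0.
have [|p2 [q2 h2]] := gpoly_dense hmu mgi _ e3.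
  by apply: fin => // v; rewrite /sqn lerDr sqr_ge0.
exists p1, q1, p2, q2.
have h2L := in_L2B (chirped_L2 p1 q1 p2 q2) f2.
rewrite -lte_fin -cnorm2E//.
apply: (@le_lt_trans _ _ ((eps / 3)%:E + (eps / 3)%:E)%E); last first.
  by rewrite -EFinD lte_fin; lra.
apply: le_trans (leeD h1 h2).
rewrite -ge0_integralD//; last 4 first.
- by move=> v _; rewrite lee_fin mulr_ge0 ?sqr_ge0 ?weight_ge0.
- apply: (@measurable_sqr_weight _ _ (fun v => Re (g v) - (gpoly p1 v + v * gpoly q1 v))).
  by apply: measurable_funB => //; exact: measurable_gpoly2.
- by move=> v _; rewrite lee_fin mulr_ge0 ?sqr_ge0 ?weight_ge0.
- apply: (@measurable_sqr_weight _ _ (fun v => Im (g v) - (gpoly p2 v + v * gpoly q2 v))).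
  by apply: measurable_funB => //; exact: measurable_gpoly2.
rewrite le_eqVlt; apply/orP; left; apply/eqP; apply: eq_integral => v _.
rewrite -EFinD -mulrDl; congr (_ * _)%:E.
have -> : chirped p1 q1 p2 q2 v - f v = expi (a * v ^+ 2 + d * v) * (gspan p1 q1 p2 q2 v - g v).
  by rewrite /chirped gE -mulrBr.
by rewrite -/(g v) sqnM sqn_expi mul1r -sqnN opprB; case: (g v).
Qed.

(** Let t tend to 0: the error terms are [t ^ 2 + t]. *)
Lemma le_of_approx (A B : R) : 0 <= B ->
  (forall t, 0 < t -> t <= 1 ->
     A <= (1 + t) * ((1 + t) * B + (1 + t^-1) * t ^+ 2) + (1 + t^-1) * t ^+ 2) -> A <= B.
Proof.
move=> B0 H; apply/ler_addgt0Pr => eps eps0.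
pose t := Num.min 1 (eps / (3 * B + 6)).
have k0 : 0 < 3 * B + 6 by lra.
have t0 : 0 < t by rewrite lt_min ltr01 divr_gt0.
have t1 : t <= 1 by rewrite ge_min lexx.
have te : t * (3 * B + 6) <= eps by rewrite -ler_pdivlMr// ge_min lexx orbT.
apply: le_trans (H t t0 t1) _.
have -> : (1 + t^-1) * t ^+ 2 = t ^+ 2 + t by field; rewrite gt_eqF.
have t2 : t ^+ 2 <= t by rewrite expr2 ler_piMl// ltW.
have tB : t ^+ 2 * B <= t * B by exact: ler_wpM2r.
have t3 : t ^+ 3 <= t by rewrite exprS ler_piMr ?(ltW t0)// expr_le1// ltW.
nra.
Qed.

Variable D : (R -> R[i]) -> (R -> R[i]).
Hypothesis hD : is_qpd_transform a b c d e mu D.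

(** Up to a relative error [1 + t], [cnorm2_approx] replaces [f] by a chirped sum of Gaussians,
    and [D f] by its transform. *)
Lemma qpd_isometry f : in_Lp mu 2 f -> cnorm2 mu (D f) = cnorm2 mu f.
Proof.
move=> f2; have [D2 _ Dc Ds] := hD.
have approx t : 0 < t -> exists h, [/\ in_Lp mu 2 h, cnorm2 mu (D h) = cnorm2 mu h,
    cnorm2 mu (fun v => h v - f v) < t ^+ 2 & cnorm2 mu (fun w => D h w - D f w) < t ^+ 2].
  move=> t0; have [del del0 hdel] := Dc f f2 t t0.
  have m0 : 0 < Num.min del t by rewrite lt_min del0.
  have [p1 [q1 [p2 [q2 hpq]]]] := chirped_dense f2 (exprn_gt0 2 m0).
  have h2 := chirped_L2 p1 q1 p2 q2.
  have sq x : 0 < x -> Num.min del t <= x -> Num.min del t ^+ 2 <= x ^+ 2.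
    by move=> x0 mx; rewrite ler_pXn2r ?nnegrE ?(ltW m0) ?(ltW x0).
  exists (chirped p1 q1 p2 q2); split => //.
  - have [LT <-] := chirped_isometry p1 q1 p2 q2.
    rewrite /cnorm2 /Rintegral; congr fine; apply: ae_eq_integral => //.
    + by have /in_L2P[_ _ L] := D2 _ h2; exact: measurable_int L.
    + exact: measurable_int LT.
    + exact: ae_eq_sqn (Ds _ (schwartz_chirp_gspan a d p1 q1 p2 q2)).
  - by apply: lt_le_trans hpq (sq _ t0 _); rewrite ge_min lexx orbT.
  - rewrite -(Lp_norm2_lt (in_L2B (D2 _ h2) (D2 _ f2)) t0).
    apply: (hdel _ h2); rewrite (Lp_norm2_lt (in_L2B h2 f2) del0).
    by apply: lt_le_trans hpq (sq _ del0 _); rewrite ge_min lexx.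
have sym (u u' : R -> R[i]) : cnorm2 mu (fun v => u v - u' v) = cnorm2 mu (fun v => u' v - u v).
  by apply: eq_Rintegral => v _; rewrite -sqnN opprB.
apply/eqP; rewrite eq_le; apply/andP; split; apply: le_of_approx; rewrite ?cnorm2_ge0//.
  move=> t t0 t1; have [h [h2 hDh hf hDf]] := approx t t0.
  have ti0 : 0 <= 1 + t^-1 by rewrite addr_ge0 ?invr_ge0 ?ltW.
  apply: le_trans (cnorm2_approx (D2 _ f2) (D2 _ h2) t0) _.
  rewrite hDh sym lerD//; last by rewrite ler_wpM2l// ltW.
  rewrite ler_wpM2l ?addr_ge0 ?(ltW t0)//.
  apply: le_trans (cnorm2_approx h2 f2 t0) _.
  by rewrite lerD2l ler_wpM2l// ltW.
move=> t t0 t1; have [h [h2 hDh hf hDf]] := approx t t0.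
have ti0 : 0 <= 1 + t^-1 by rewrite addr_ge0 ?invr_ge0 ?ltW.
apply: le_trans (cnorm2_approx f2 h2 t0) _.
rewrite -hDh sym lerD//; last by rewrite ler_wpM2l// ltW.
rewrite ler_wpM2l ?addr_ge0 ?(ltW t0)//.
apply: le_trans (cnorm2_approx (D2 _ h2) (D2 _ f2) t0) _.
by rewrite lerD2l ler_wpM2l// ltW.
Qed.

(** Polarization, with the linearity of [D]. *)
Lemma qpd_rinner k f g : in_Lp mu 2 f -> in_Lp mu 2 g ->
  rinner mu k (D f) (D g) = rinner mu k f g.
Proof.
move=> f2 g2; have [D2 Dl _ _] := hD.
have kfg := in_L2_comb k f2 g2.
have := qpd_isometry kfg; rewrite (cnorm2_polar k f2 g2).
rewrite (cnorm2_ae (D2 _ kfg) (in_L2_comb k (D2 _ f2) (D2 _ g2)) (Dl k f g f2 g2)).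
rewrite (cnorm2_polar k (D2 _ f2) (D2 _ g2)) !qpd_isometry//; lra.
Qed.

End plancherel.

Theorem theorem3p7 (R : realType) (a b c d e mu : R)
  (hb : b != 0) (hmu : - (1 / 2) <= mu)
  (D : (R -> R[i]) -> (R -> R[i]))
  (hD : is_qpd_transform a b c d e mu D)
  (f g : R -> R[i]) (hf : in_Lp mu 2 f) (hg : in_Lp mu 2 g) :
  cintegral (fun v => f v * conjc (g v) * (weight mu v)%:C) =
  cintegral (fun w => D f w * conjc (D g w) * (weight mu w)%:C).
Proof. by rewrite !cintegral_rinner !(qpd_rinner hb hmu hD). Qed.
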